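(* Let $0<\alpha<1$ and let $f,g\in\mathcal{S}(\mathbb{R})$ be Schwartz functions. Then for every $\xi\in\mathbb{R}$, $$D_{\xi}^{\alpha} f\cdot g(\xi)=C_{\alpha}\int_{0}^{\infty}\frac{f(\xi)\,g(\xi-y)-f(\xi-y)\,g(\xi)}{y^{1+\alpha}}\,dy,\qquad C_\alpha=\frac{\alpha}{\Gamma(1-\alpha)}=-\frac{1}{\Gamma(-\alpha)}.$$
   Context: Fourier transform convention: $\widehat{f}(k)=\int_{\mathbb{R}} f(\xi)e^{-ik\xi}\,d\xi$, with inverse $f(\xi)=\frac{1}{2\pi}\int_{\mathbb{R}}\widehat{f}(k)e^{ik\xi}\,dk$. For $0<\alpha\le 1$ the spectral fractional derivative $D_\xi^\alpha f$ of a single function $f\in\mathcal{S}(\mathbb{R})$ is defined by $\widehat{D_\xi^\alpha f}(k)=(ik)^\alpha\widehat{f}(k)$, where $(ik)^\alpha$ is the principal branch (with $0^\alpha=0$). The spectral fractional Hirota bilinear operator is defined by $$D_\xi^\alpha f\cdot g:=(D_\xi^\alpha f)\,g-f\,(D_\xi^\alpha g).$$ Here $D_\xi^\alpha f\cdot g$ always denotes this bilinear operator applied to the pair $(f,g)$, not the product of $D_\xi^\alpha f$ with $g$. $\Gamma$ is the Euler Gamma function. *)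

(* Defs.v *)
From HB Require Import structures.
From mathcomp Require Import all_boot all_order all_algebra.
From mathcomp Require Import all_classical all_reals all_analysis.
From mathcomp Require Export complex.

Set Implicit Arguments.
Unset Strict Implicit.
Unset Printing Implicit Defensive.

Import Order.TTheory GRing.Theory Num.Theory.
Import numFieldNormedType.Exports.

Local Open Scope classical_set_scope.
Local Open Scope ring_scope.
Local Open Scope complex_scope.

Definition cmod (R : realType) (z : R[i]) : R := ComplexField.Normc.normc z.

Definition cexp (R : realType) (z : R[i]) : R[i] :=
  (expR (complex.Re z))%:C * (cos (complex.Im z) +i* sin (complex.Im z)).

(* Principal argument, with values in ]-pi, pi] (irrelevant at z = 0). *)
Definition carg (R : realType) (z : R[i]) : R :=
  let t := acos (complex.Re z / cmod z) in
  if 0 <= complex.Im z then t else - t.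

Definition clog (R : realType) (z : R[i]) : R[i] := ln (cmod z) +i* carg z.

(* Principal branch of z ^ a, with the convention 0 ^ a = 0. *)
Definition cpow (R : realType) (z : R[i]) (a : R) : R[i] :=
  if z == 0 then 0 else cexp (a%:C * clog z).

(* A complex function of a real variable is differentiated and integrated
   componentwise. *)
Definition cderiven (R : realType) (n : nat) (f : R -> R[i]) (x : R) : R[i] :=
  derive1n n (@complex.Re R \o f) x +i* derive1n n (@complex.Im R \o f) x.

Definition csmooth (R : realType) (f : R -> R[i]) : Prop :=
  forall (n : nat) (x : R),
    derivable (derive1n n (@complex.Re R \o f)) x 1 /\
    derivable (derive1n n (@complex.Im R \o f)) x 1.

Definition schwartz (R : realType) (f : R -> R[i]) : Prop :=
  csmooth f /\
  forall m n : nat, exists M : R,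
    forall x : R, `|x| ^+ m * cmod (cderiven n f x) <= M.

Definition cintegrable (R : realType) (D : set R) (f : R -> R[i]) : Prop :=
  (@lebesgue_measure R).-integrable D (EFin \o (@complex.Re R \o f)) /\
  (@lebesgue_measure R).-integrable D (EFin \o (@complex.Im R \o f)).

Definition cintegral (R : realType) (D : set R) (f : R -> R[i]) : R[i] :=
  Rintegral (@lebesgue_measure R) D (@complex.Re R \o f) +i*
  Rintegral (@lebesgue_measure R) D (@complex.Im R \o f).

Definition fourier (R : realType) (f : R -> R[i]) (k : R) : R[i] :=
  cintegral setT (fun x => f x * cexp (0 +i* - (k * x))).

Definition inverse_fourier (R : realType) (F : R -> R[i]) (x : R) : R[i] :=
  ((2 * pi)^-1)%:C * cintegral setT (fun k => F k * cexp (0 +i* (k * x))).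

(* D^a f is the function whose Fourier transform is (i k) ^ a times that of f;
   for f Schwartz and 0 < a this product is integrable in k. *)
Definition fracD (R : realType) (a : R) (f : R -> R[i]) : R -> R[i] :=
  inverse_fourier (fun k => cpow (0 +i* k) a * fourier f k).

Definition hirota (R : realType) (a : R) (f g : R -> R[i]) (x : R) : R[i] :=
  fracD a f x * g x - f x * fracD a g x.

Definition euler_integral (R : realType) (x : R) : R :=
  Rintegral (@lebesgue_measure R) `]0, +oo[
    (fun t => t `^ (x - 1) * expR (- t)).

(* Euler's integral for x > 0; for x <= 0 the continuation given by
   Gamma (x + n) = x (x + 1) ... (x + n - 1) Gamma x, where n is the least
   natural number with x + n > 0.  At the poles 0, -1, -2, ... the value is 0
   (division by 0). *)
Definition Gamma (R : realType) (x : R) : R :=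
  let n := if 0 < x then 0%N else (Num.truncn (- x)).+1 in
  euler_integral (x + n%:R) / \prod_(i < n) (x + i%:R).

(* Main.v *)
Require Import Defs.
From mathcomp Require Import all_boot all_order all_algebra.
From mathcomp Require Import all_classical all_reals all_analysis.
From mathcomp Require Import measurable_realfun ring lra.

(** Everything follows from the Marchaud representation of the fractional
    derivative of a single Schwartz function,
      [D^a f xi = a / Gamma (1 - a) *
        int_0^oo (f xi - f (xi - y)) / y ^ (1 + a) dy]:
    inserting it in [(D^a f) g - f (D^a g)], the terms [f xi * g xi] cancel, and
    the rest is the asserted integral.

    The Marchaud formula holds because the increment [f xi - f (xi - y)] has, at
    the frequency [k], the factor [1 - e^(- i k y)], and because
      [int_0^oo (1 - e^(- s y)) / y ^ (1 + a) dy = Gamma (1 - a) / a * s ^ a]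
    at [s = i k].  Its proof has three ingredients: Fourier inversion
    ([wave_inversion]), the value of this integral ([oscillatory_kernel]), and an
    exchange of the integrals over [k] and [y] ([marchaud_real]), which is
    absolutely convergent because the transform of [f] decays fast.

    Inversion is proved with Abel means: the weight [e^(- e |k|)] has the Poisson
    kernel as its transform, and this kernel is an approximate identity.

    The integral, as a function [Phi s], satisfies [s * Phi' s = a * Phi s] in the
    open right half-plane, by an integration by parts.  Hence [Phi s / s ^ a] is
    constant along the path [e^(t (l + i h))] that joins 1 to [i k]
    ([path_integral_const]), the last point being reached by dominated
    convergence.  At [s = 1] another integration by parts gives
    [Phi 1 = Gamma (1 - a) / a].  The path is the exponential of a segment ending
    at the principal logarithm of [i k], so [s ^ a] is the principal branch there.

    All integrals are real: a complex quantity [z] is represented by the real parts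
    of [e^(i phi) * z] for all phases [phi].  The complex operations are
    recovered in [symbol_wave] and [fracD_marchaud]. *)

Set Implicit Arguments.
Unset Strict Implicit.
Unset Printing Implicit Defensive.

Import Order.TTheory GRing.Theory Num.Theory.
Import numFieldNormedType.Exports.

Local Open Scope classical_set_scope.
Local Open Scope ring_scope.
Local Open Scope complex_scope.

Local Notation mu := (@lebesgue_measure _).

(** * Dominated integration *)

Lemma integrable_dominated (R : realType) (D : set R) (f g : R -> R) :
  measurable D -> measurable_fun D f -> mu.-integrable D (EFin \o g) ->
  (forall x, D x -> `|f x| <= g x) -> mu.-integrable D (EFin \o f).
Proof.
move=> mD mf ig fg; apply: (le_integrable _ _ _ ig) => //.
  by apply/measurable_EFinP; exact: mf.
by move=> x Dx /=; rewrite lee_fin (le_trans (fg _ Dx))// ler_norm.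
Qed.

Lemma Rintegral_dominated_cvg (R : realType) (D : set R) (f_ : nat -> R -> R)
    (f g : R -> R) :
  measurable D -> (forall n, measurable_fun D (f_ n)) ->
  (forall x, D x -> f_ n x @[n --> \oo] --> f x) ->
  mu.-integrable D (EFin \o g) ->
  (forall n x, D x -> `|f_ n x| <= g x) ->
  mu.-integrable D (EFin \o f) /\
  Rintegral mu D (f_ n) @[n --> \oo] --> Rintegral mu D f.
Proof.
move=> mD mf_ f_f ig fg.
have mf : measurable_fun D f by exact: measurable_fun_cvg f_f.
have [] := @dominated_convergence _ _ _ mu D _ (fun n => EFin \o f_ n)
  (EFin \o f) (EFin \o g) _ _ _ ig _.
- by [].
- by move=> n; apply/measurable_EFinP; exact: mf_.
- by apply/measurable_EFinP; exact: mf.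
- apply: aeW => x Dx; apply: cvg_EFin; first exact: nearW.
  exact: f_f.
- by apply: aeW => x n Dx /=; rewrite lee_fin fg.
move=> intf _ H; split => //; apply: fine_cvg.
rewrite fineK //; exact: integrable_fin_num.
Qed.

(** * The fundamental theorem of calculus on unbounded intervals *)

(** Integrals over an unbounded or half-open [D] are reached as limits of integrals
    over the segments [`[a n, b n]], where the fundamental theorem applies. *)
Definition exhausts (R : realType) (D : set R) (a b : nat -> R) :=
  [/\ forall n, a n < b n,
      forall n, `[a n, b n]%classic `<=` D &
      forall x, D x -> \forall n \near \oo, a n <= x <= b n].

Lemma Rintegral_segment (R : realType) (D : set R) (F f : R -> R) (a b : R) :
  a < b -> `[a, b]%classic `<=` D ->
  (forall x, D x -> is_derive x 1 F (f x)) ->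
  (forall x, D x -> {for x, continuous f}) ->
  (\int[mu]_(x in `[a, b]) (f x)%:E = (F b - F a)%:E)%E.
Proof.
move=> ab sD dF cf.
have cF : {within `[a, b], continuous F}.
  apply: derivable_within_continuous => x xab.
  by have [] := dF x (sD _ xab).
rewrite (@continuous_FTC2 _ f F)//.
- by apply: continuous_in_subspaceT => x /set_mem/sD/cf.
- have [dFo cFa cFb] := (continuous_within_itvP _ ab).1 cF.
  split => // x /subset_itv_oo_cc xab.
  by have [] := dF x (sD _ xab).
- move=> x /subset_itv_oo_cc xab; rewrite derive1E.
  by have [] := dF x (sD _ xab).
Qed.

(** A nonnegative derivative of a bounded function is integrable: its integrals
    over the exhausting segments are increments of [F], so at most [2 M], and
    Fatou's lemma passes this bound to [D]. *)
Lemma integrable_derive (R : realType) (D : set R) (a b : nat -> R)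
    (F f : R -> R) (M : R) :
  measurable D -> measurable_fun D f -> exhausts D a b ->
  (forall x, D x -> is_derive x 1 F (f x)) ->
  (forall x, D x -> {for x, continuous f}) ->
  (forall x, D x -> 0 <= f x) ->
  (forall x, D x -> `|F x| <= M) ->
  mu.-integrable D (EFin \o f).
Proof.
move=> mD mf [ab sD eD] dF cf f0 FM.
apply/integrableP; split; first by apply/measurable_EFinP; exact: mf.
pose g n := (EFin \o f) \_ `[a n, b n].
have g0 n x : (0 <= g n x)%E.
  by apply: erestrict_ge0 => y yab /=; rewrite lee_fin f0//; exact: sD yab.
have -> : (\int[mu]_(x in D) `|(EFin \o f) x| =
           \int[mu]_(x in D) (limn_einf (g ^~ x)))%E.
  apply: eq_integral => x /set_mem Dx.
  rewrite gee0_abs ?lee_fin ?f0//; apply/esym; apply: (cvg_limn_einf_sup _).1.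
  apply: cvg_near_cst; have := eD x Dx; apply: filterS => n xab.
  by rewrite /g patchE mem_set.
apply: (@le_lt_trans _ _ (limn_einf (fun n => \int[mu]_(x in D) g n x))%E).
  apply: fatou => //= n; apply/(measurable_restrict _ _ _).1 => //.
  by apply/measurable_EFinP; exact: measurable_funS mf.
apply: (@le_lt_trans _ _ (M + M)%:E%E); last exact: ltry.
rewrite limn_einf_lim; apply: lime_le; first exact: is_cvg_einfs.
apply: nearW => n; apply: (@le_trans _ _ (\int[mu]_(x in D) g n x)%E).
  by apply: ereal_inf_lbound; exists n => //=.
rewrite /g -integral_mkcondr setIidr// (Rintegral_segment (ab n) (sD n) dF cf)//.
rewrite lee_fin (le_trans (ler_norm _))// (le_trans (ler_normB _ _))//.
by rewrite lerD// FM//; apply: (sD n); rewrite /= in_itv/= lexx ltW.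
Qed.

(** All integrations by parts below, with their boundary terms, are instances of
    this statement: the integral of a derivative is the limit of the increments
    of its primitive, by dominated convergence with bound [`|f|]. *)
Lemma Rintegral_derive (R : realType) (D : set R) (a b : nat -> R)
    (F f : R -> R) (l : R) :
  measurable D -> exhausts D a b ->
  (forall x, D x -> is_derive x 1 F (f x)) ->
  (forall x, D x -> {for x, continuous f}) ->
  mu.-integrable D (EFin \o f) ->
  F (b n) - F (a n) @[n --> \oo] --> l ->
  Rintegral mu D f = l.
Proof.
move=> mD [ab sD eD] dF cf intf Fl.
have mf : measurable_fun D f by apply/measurable_EFinP; exact: measurable_int intf.
have [] := @Rintegral_dominated_cvg _ D (fun n => f \_ `[a n, b n]) f
  (fun x => `|f x|) mD.
- move=> n; apply/(measurable_restrict _ _ _).1 => //.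
  exact: measurable_funS mf.
- move=> x Dx; apply: cvg_near_cst; have := eD x Dx; apply: filterS => n xab.
  by rewrite patchE mem_set.
- exact: integrable_norm.
- by move=> n x _; rewrite patchE; case: ifP => //; rewrite normr0.
move=> _ H; apply: (cvg_unique _ H) => //.
apply: cvg_trans Fl; apply: near_eq_cvg; apply: nearW => n.
rewrite -Rintegral_mkcondr setIidr// /Rintegral.
by rewrite (Rintegral_segment (ab n) (sD n) dF cf).
Qed.

Lemma integrable_scale (R : realType) (D : set R) (c : R) (f : R -> R) :
  measurable D -> mu.-integrable D (EFin \o f) ->
  mu.-integrable D (EFin \o (fun x => c * f x)).
Proof. by move=> mD /(integrableZl _ c); apply. Qed.

Lemma integrable_add (R : realType) (D : set R) (f g : R -> R) :
  measurable D -> mu.-integrable D (EFin \o f) ->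
  mu.-integrable D (EFin \o g) ->
  mu.-integrable D (EFin \o (fun x => f x + g x)).
Proof. by move=> mD /(integrableD _) /[apply]; apply. Qed.

Lemma integrable_sub (R : realType) (D : set R) (f g : R -> R) :
  measurable D -> mu.-integrable D (EFin \o f) ->
  mu.-integrable D (EFin \o g) ->
  mu.-integrable D (EFin \o (fun x => f x - g x)).
Proof. by move=> mD /(integrableB _) /[apply]; apply. Qed.

Lemma integrable_patch (R : realType) (D : set R) (f : R -> R) :
  measurable D ->
  mu.-integrable D (EFin \o f) <-> mu.-integrable setT (EFin \o (f \_ D)).
Proof.
move=> mD; rewrite -restrict_EFin.
by apply: (@integrable_mkcond _ _ _ mu D (EFin \o f)); exact: mD.
Qed.

Lemma integrable_itv (R : realType) (i : interval R) (f : R -> R) :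
  mu.-integrable setT (EFin \o f) -> mu.-integrable [set` i] (EFin \o f).
Proof. by apply: integrableS => //; exact: measurable_itv. Qed.

Lemma Rintegral_scale (R : realType) (D : set R) (c : R) (f : R -> R) :
  measurable D -> mu.-integrable D (EFin \o f) ->
  Rintegral mu D (fun x => c * f x) = c * Rintegral mu D f.
Proof. by move=> mD intf; exact: RintegralZl. Qed.

Lemma exhausts_setT (R : realType) :
  exhausts [set: R] (fun n => - n.+1%:R) (fun n => n.+1%:R).
Proof.
split=> [n|//|x _]; first by rewrite gtrN.
near=> n; rewrite -ler_norml (@le_trans _ _ n%:R) ?ler_nat//.
by near: n; exact: nbhs_infty_ger.
Unshelve. all: by end_near. Qed.

Lemma exhausts_pos (R : realType) :
  exhausts `]0, +oo[%classic (fun n => n.+2%:R^-1 : R) (fun n => n.+2%:R).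
Proof.
split=> [n|n x|x]; rewrite /= ?in_itv/= ?andbT.
- by rewrite (@lt_trans _ _ 1)// ?invf_lt1// ltr1n.
- by move=> /andP[+ _]; apply: lt_le_trans; rewrite invr_gt0.
- move=> x0; near=> n; apply/andP; split.
    rewrite -[leRHS]invrK lef_pV2 ?posrE ?invr_gt0//.
    by rewrite (@le_trans _ _ n%:R) ?ler_nat ?leqW//; near: n; exact: nbhs_infty_ger.
  by rewrite (@le_trans _ _ n%:R) ?ler_nat ?leqW//; near: n; exact: nbhs_infty_ger.
Unshelve. all: by end_near. Qed.

Lemma exhausts_0c (R : realType) (c : R) : 0 < c ->
  exhausts `]0, c]%classic (fun n => c / n.+2%:R) (fun=> c).
Proof.
move=> c0; split=> [n|n x|x]; rewrite /= ?in_itv/=.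
- by rewrite ltr_pdivrMr// ltr_pMr// ltr1n.
- by move=> /andP[+ ->]; rewrite andbT; apply: lt_le_trans; rewrite divr_gt0.
- move=> /andP[x0 ->]; near=> n; rewrite andbT.
  rewrite ler_pdivrMr// mulrC -ler_pdivrMr//.
  by rewrite (@le_trans _ _ n%:R) ?ler_nat ?leqW//; near: n; exact: nbhs_infty_ger.
Unshelve. all: by end_near. Qed.

Lemma exhausts_cy (R : realType) (c : R) :
  exhausts `[c, +oo[%classic (fun=> c) (fun n => c + n.+1%:R).
Proof.
split=> [n|n x|x]; rewrite /= ?in_itv/= ?andbT; first by rewrite ltrDl.
  by case/andP.
move=> ->; near=> n; rewrite -lerBlDl/=.
by rewrite (@le_trans _ _ n%:R) ?ler_nat ?leqW//; near: n; exact: nbhs_infty_ger.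
Unshelve. all: by end_near. Qed.

(** * Exchange of integrals *)

(** A product bound [a x * b y] makes [F] integrable for the product measure by
    Tonelli, so that Fubini applies; sections are then integrable for every
    point, not only almost everywhere. *)
Lemma Rintegral_swap (R : realType) (A B : set R) (F : R -> R -> R)
    (a b : R -> R) :
  measurable A -> measurable B ->
  measurable_fun [set: R * R] (fun p => F p.1 p.2) ->
  mu.-integrable A (EFin \o a) -> mu.-integrable B (EFin \o b) ->
  (forall x y, A x -> B y -> `|F x y| <= a x * b y) ->
  [/\ mu.-integrable A (EFin \o (fun x => Rintegral mu B (F x))),
      mu.-integrable B (EFin \o (fun y => Rintegral mu A (F ^~ y))) &
      Rintegral mu A (fun x => Rintegral mu B (F x)) =
      Rintegral mu B (fun y => Rintegral mu A (F ^~ y))].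
Proof.
move=> mA mB mF ia ib Fab.
pose G := (fun p : measurableTypeR R * measurableTypeR R => (F p.1 p.2)%:E) \_ (A `*` B).
have mG : measurable_fun setT G.
  apply/(measurable_restrictT _ _).1; first exact: measurableX.
  by apply: measurable_funTS; apply/measurable_EFinP; exact: mF.
have mFx x : measurable_fun [set: R] (F x).
  have := measurableT_comp mF (@measurable_pair1 _ _ R R x) .
  exact.
have mFy y : measurable_fun [set: R] (F^~ y).
  have := measurableT_comp mF (@measurable_pair2 _ _ R R y) .
  exact.
have iFx x : A x -> mu.-integrable B (EFin \o F x).
  move=> Ax; apply: (@integrable_dominated _ _ _ (fun y => a x * b y)) => //.
  - by apply: measurable_funTS; exact: mFx.
  - exact: integrable_scale.
  - by move=> y; exact: Fab.
have iFy y : B y -> mu.-integrable A (EFin \o F^~ y).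
  move=> By; apply: (@integrable_dominated _ _ _ (fun x => b y * a x)) => //.
  - by apply: measurable_funTS; exact: mFy.
  - exact: integrable_scale.
  - by move=> x Ax; rewrite mulrC; exact: Fab.
have GA x : (\int[mu]_y G (x, y) = ((fun x => Rintegral mu B (F x)) \_ A x)%:E)%E.
  rewrite patchE; case: ifPn => [/set_mem Ax|/negP nAx].
    rewrite /Rintegral fineK; last exact: integrable_fin_num (iFx _ Ax).
    rewrite integral_mkcond; apply: eq_integral => y _.
    by rewrite /G !patchE in_setX /= mem_set.
  rewrite integral0_eq// => y _; rewrite /G patchE in_setX.
  by case: (boolP (x \in A)) => // /nAx.
have GB y : (\int[mu]_x G (x, y) = ((fun y => Rintegral mu A (F ^~ y)) \_ B y)%:E)%E.
  rewrite patchE; case: ifPn => [/set_mem By|/negP nBy].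
    rewrite /Rintegral fineK; last exact: integrable_fin_num (iFy _ By).
    rewrite integral_mkcond; apply: eq_integral => x _.
    by rewrite /G !patchE in_setX /= (mem_set By) andbT.
  rewrite integral0_eq// => x _; rewrite /G patchE in_setX.
  by case: (boolP (y \in B)) => [/nBy//|]; rewrite andbF.
have iG : (mu \x mu)%E.-integrable setT G.
  apply/integrable12ltyP => //.
  pose aA := (fun x => `|a x|) \_ A; pose bB := (fun y => `|b y|) \_ B.
  have iaA : mu.-integrable setT (EFin \o aA).
    by apply: (integrable_patch _ mA).1; exact: (integrable_norm ia).
  have ibB : mu.-integrable setT (EFin \o bB).
    by apply: (integrable_patch _ mB).1; exact: (integrable_norm ib).
  have aA0 x : 0 <= aA x by apply: restrict_ge0.
  have bB0 y : 0 <= bB y by apply: restrict_ge0.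
  have Gab x y : (`|G (x, y)| <= (aA x * bB y)%:E)%E.
    rewrite /G /aA /bB !patchE in_setX /=.
    case: ifPn => [/andP[/[dup] /set_mem Ax -> /[dup] /set_mem By ->]|nAB].
      by rewrite lee_fin (le_trans (Fab _ _ Ax By))// -normrM ler_norm.
    by rewrite abse0 lee_fin mulr_ge0//; [exact: aA0|exact: bB0].
  pose K := Rintegral mu setT bB.
  have Gx x : (\int[mu]_y `|G (x, y)| <= (aA x * K)%:E)%E.
    rewrite EFinM /K /Rintegral fineK; last exact: integrable_fin_num ibB.
    rewrite -integralZl//; apply: ge0_le_integral => //=.
    - by apply: measurableT_comp => //; exact: measurableT_comp.
    - exact: measurable_int (integrable_scale (aA x) measurableT ibB).
  have iaK : mu.-integrable setT (EFin \o (fun x => K * aA x)).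
    exact: integrable_scale.
  have /integrableP[mK iKoo] := iaK; apply: le_lt_trans iKoo.
  apply: ge0_le_integral => //=.
  - by move=> x _; exact: integral_ge0.
  - by apply: (measurable_fun_fubini_tonelli_F (m2:=mu) (abse \o G)) => //=;
      exact: measurableT_comp.
  - exact: measurable_int (integrable_norm iaK).
  - by move=> x _; rewrite (le_trans (Gx x))// mulrC lee_fin ler_norm.
have iA := integrable_fubini_F iG.
have FG := Fubini iG.
have iB : mu.-integrable setT (fubini_G mu G).
  apply/integrableP; split; first exact: (measurable_fubini_G iG).
  have Goo : (\int[mu]_y \int[mu]_x `|G (x, y)| < +oo)%E.
    exact: (integrable21ltyP mu mu mG).1 iG.
  apply: le_lt_trans Goo.
  have mGy y : measurable_fun setT (fun x => G (x, y)) by exact: measurableT_comp.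
  apply: ge0_le_integral.
  - by [].
  - by [].
  - exact: measurableT_comp (measurable_fubini_G iG).
  - apply: (measurable_fun_fubini_tonelli_G (m1:=mu) (abse \o G)) => //=;
      exact: measurableT_comp.
  - move=> y Ty; apply: le_abse_integral => //; exact: mGy.
have iA' : mu.-integrable A (EFin \o (fun x => Rintegral mu B (F x))).
  apply: (integrable_patch _ mA).2.
  by apply: eq_integrable iA => // x _; rewrite /= -GA.
have iB' : mu.-integrable B (EFin \o (fun y => Rintegral mu A (F ^~ y))).
  apply: (integrable_patch _ mB).2.
  by apply: eq_integrable iB => // y _; rewrite /= -GB.
split => //; rewrite (@Rintegral_mkcond _ _ _ mu A) (@Rintegral_mkcond _ _ _ mu B).
congr fine; under eq_integral do rewrite -GA.
by rewrite FG; apply: eq_integral => y _; rewrite GB.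
Qed.

(** * The Cauchy density *)

Lemma is_derive_continuous (R : realType) (f : R -> R) (x a : R) :
  is_derive x 1 f a -> {for x, continuous f}.
Proof. by case=> df _; apply: differentiable_continuous; exact/derivable1_diffP. Qed.

Lemma measurable_derivable (R : realType) (f g : R -> R) :
  (forall x : R, is_derive x 1 f (g x)) -> measurable_fun setT f.
Proof.
by move=> df; apply: continuous_measurable_fun => x; exact: is_derive_continuous (df x).
Qed.

Lemma cvg_harmonic_bound (R : realType) (c : R) (u : nat -> R) :
  (forall n, `|u n| <= c / n.+1%:R) -> u n @[n --> \oo] --> 0.
Proof.
move=> uc; apply: norm_cvg0.
apply: (@squeeze_cvgr _ _ _ _ (fun=> 0) (fun n => c * harmonic n)).
- by apply: nearW => n; rewrite normr_ge0 uc.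
- exact: cvg_cst.
- by rewrite -[X in _ --> X](mulr0 c); apply: cvgMl_tmp; exact: cvg_harmonic.
Qed.

Lemma cauchy_den_gt0 (R : realType) (e z : R) : 0 < e -> 0 < e ^+ 2 + z ^+ 2.
Proof. by move=> e0; rewrite ltr_pwDl ?exprn_gt0 ?sqr_ge0. Qed.

Lemma is_derive_atan_scaled (R : realType) (e c x : R) : 0 < e ->
  is_derive x 1 (fun y => atan ((y - c) / e)) (e / (e ^+ 2 + (x - c) ^+ 2)).
Proof.
move=> e0; apply: is_derive_eq.
rewrite /GRing.scale /=; field.
by rewrite !gt_eqF//; exact: cauchy_den_gt0.
Qed.

Lemma continuous_cauchy (R : realType) (e c : R) : 0 < e ->
  forall x : R, {for x, continuous (fun x => e / (e ^+ 2 + (x - c) ^+ 2))}.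
Proof.
move=> e0 x; apply: cvgM; first exact: cvg_cst.
apply: cvgV; first by rewrite gt_eqF// cauchy_den_gt0.
apply: (@is_derive_continuous _ (fun x => e ^+ 2 + (x - c) ^+ 2)).
Qed.

Lemma measurable_cauchy (R : realType) (e c : R) : 0 < e ->
  measurable_fun [set: R] (fun x => e / (e ^+ 2 + (x - c) ^+ 2)).
Proof.
by move=> e0; apply: continuous_measurable_fun => x; exact: continuous_cauchy.
Qed.

(** This function (a multiple of the Poisson kernel of the half-plane) has two
    roles: for [e = 1] it is the standard integrable bound, and for [e] tending
    to 0 it is an approximate identity. *)
Lemma integrable_cauchy (R : realType) (e c : R) : 0 < e ->
  mu.-integrable [set: R] (EFin \o (fun x => e / (e ^+ 2 + (x - c) ^+ 2))).
Proof.
move=> e0.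
apply: (integrable_derive (F := fun y => atan ((y - c) / e)) (M := pi)
  _ _ (exhausts_setT R)) => //.
- exact: measurable_cauchy.
- by move=> x _; exact: is_derive_atan_scaled.
- by move=> x _; exact: continuous_cauchy.
- by move=> x _; rewrite divr_ge0// ltW// cauchy_den_gt0.
- move=> x _; rewrite ler_norml.
  have := atan_gtNpi2 ((x - c) / e); have := atan_ltpi2 ((x - c) / e).
  have := pi_gt0 R; lra.
Qed.

Lemma Rintegral_cauchy (R : realType) (e c : R) : 0 < e ->
  Rintegral mu [set: R] (fun x => e / (e ^+ 2 + (x - c) ^+ 2)) = pi.
Proof.
move=> e0.
apply: (Rintegral_derive (F := fun y => atan ((y - c) / e))
  _ (exhausts_setT R)) => //.
- by move=> x _; exact: is_derive_atan_scaled.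
- by move=> x _; exact: continuous_cauchy.
- exact: integrable_cauchy.
have h (b : R) : atan ((n.+1%:R + b) / e) @[n --> \oo] --> pi / 2.
  apply: (@cvg_comp _ _ _ (fun n : nat => (n.+1%:R + b) / e) atan _ +oo);
    last exact: cvgy_atan.
  apply/cvgryPge => A; near=> n.
  rewrite ler_pdivlMr// -lerBlDr.
  by rewrite (@le_trans _ _ n%:R) ?ler_nat//; near: n; exact: nbhs_infty_ger.
rewrite (_ : pi = pi / 2 + pi / 2); last by lra.
under eq_fun => n do rewrite -opprD mulNr atanN opprK.
apply: cvgD; last exact: h.
exact: h.
Unshelve. all: by end_near. Qed.

(** * Real Schwartz functions and their frequency components *)

Lemma lipschitz_derive (R : realType) (f g : R -> R) (L : R) :
  (forall x : R, is_derive x 1 f (g x)) -> (forall x, `|g x| <= L) ->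
  forall x y, `|f x - f y| <= L * `|x - y|.
Proof.
move=> df gL.
have H x y : x < y -> `|f y - f x| <= L * `|y - x|.
  move=> xy; have [|c _ ->] := @MVT _ f g x y xy (fun z _ => df z).
    by apply: derivable_within_continuous => z _; have [] := df z.
  by rewrite normrM ler_wpM2r.
move=> x y; case: (ltgtP x y) => [xy|yx|->]; last by rewrite !subrr normr0 mulr0.
- by rewrite distrC [`|x - y|]distrC; exact: H.
- exact: H.
Qed.

Lemma cos_lipschitz (R : realType) (x y : R) : `|cos x - cos y| <= `|x - y|.
Proof.
rewrite -[leRHS]mul1r; apply: (lipschitz_derive (g := fun z => - sin z)) => z.
by rewrite normrN sin_max.
Qed.

Definition rschwartz (R : realType) (u : R -> R) : Prop :=
  (forall (n : nat) (x : R), derivable (derive1n n u) x 1) /\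
  forall m n : nat, exists M : R, forall x : R,
    `|x| ^+ m * `|derive1n n u x| <= M.

Lemma rschwartz_derive1 (R : realType) (u : R -> R) :
  rschwartz u -> rschwartz (derive1 u).
Proof.
have E n : derive1n n (derive1 u) = derive1n n.+1 u.
  by elim: n => // n; rewrite /derive1n /= => ->.
move=> [du uM]; split=> [n x|m n]; first by rewrite E.
by have [M HM] := uM m n.+1; exists M => x; rewrite E.
Qed.

Lemma rschwartz_is_derive (R : realType) (u : R -> R) : rschwartz u ->
  forall x : R, is_derive x 1 u (derive1 u x).
Proof. by move=> [du _] x; rewrite derive1E; exact/derivableP/(du 0). Qed.

Lemma rschwartz_continuous (R : realType) (u : R -> R) : rschwartz u ->
  forall x : R, {for x, continuous u}.
Proof. by move=> su x; exact: is_derive_continuous (rschwartz_is_derive su x). Qed.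

Lemma rschwartz_measurable (R : realType) (u : R -> R) : rschwartz u ->
  measurable_fun setT u.
Proof.
by move=> su; apply: continuous_measurable_fun => x; exact: rschwartz_continuous.
Qed.

(** The bound is written in the form of [integrable_cauchy]. *)
Lemma rschwartz_decay (R : realType) (u : R -> R) : rschwartz u ->
  exists2 M, 0 <= M & forall x, `|u x| <= M * (1 / (1 ^+ 2 + (x - 0) ^+ 2)).
Proof.
move=> [_ uM]; have [M0 HM0] := uM 0 0; have [M2 HM2] := uM 2 0.
have M00 : 0 <= M0 by rewrite (le_trans _ (HM0 0))// expr0 mul1r.
have M20 : 0 <= M2 by rewrite (le_trans _ (HM2 0))// mulr_ge0.
exists (M0 + M2) => [|x]; first exact: addr_ge0.
rewrite mul1r subr0 expr1n ler_pdivlMr ?ltr_pwDl ?sqr_ge0//.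
have := HM0 x; have := HM2 x; rewrite expr0 mul1r /= real_normK ?num_real//.
by rewrite mulrDr mulr1 mulrC => ? ?; rewrite lerD.
Qed.

Lemma rschwartz_bounded (R : realType) (u : R -> R) : rschwartz u ->
  exists2 M, 0 <= M & forall x, `|u x| <= M.
Proof.
move=> [_ uM]; have [M HM] := uM 0 0; exists M => [|x].
  by rewrite (le_trans _ (HM 0))// expr0 mul1r.
by have := HM x; rewrite expr0 mul1r.
Qed.

Lemma rschwartz_mul_integrable (R : realType) (u w : R -> R) : rschwartz u ->
  measurable_fun setT w -> (forall x, `|w x| <= 1) ->
  mu.-integrable setT (EFin \o (fun x => u x * w x)).
Proof.
move=> su mw w1; have [M M0 uM] := rschwartz_decay su.
apply: (@integrable_dominated _ _ _
  (fun x => M * (1 / (1 ^+ 2 + (x - 0) ^+ 2)))) => //.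
- by apply: measurable_funM => //; exact: rschwartz_measurable.
- by apply: integrable_scale => //; exact: integrable_cauchy.
- by move=> x _; rewrite normrM (le_trans _ (uM x))// ler_piMr.
Qed.

(** This is the real part of [e^(i phi) * uhat k * e^(i k xi)], where [uhat] is the
    Fourier transform of the real function [u].  The phase [phi] replaces complex
    arithmetic: a complex number [z] is known once the real parts of
    [e^(i phi) * z] are, and multiplying [z] by [e^(i t)] shifts [phi] by [t]. *)
Definition wave (R : realType) (u : R -> R) (xi k phi : R) : R :=
  Rintegral mu setT (fun x => u x * cos (phi + k * (xi - x))).

Lemma measurable_phase (R : realType) (xi k phi : R) :
  measurable_fun setT (fun x : R => cos (phi + k * (xi - x))).
Proof. exact: measurable_derivable. Qed.

Lemma wave_integrable (R : realType) (u : R -> R) (xi k phi : R) :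
  rschwartz u ->
  mu.-integrable setT (EFin \o (fun x => u x * cos (phi + k * (xi - x)))).
Proof.
move=> su; apply: rschwartz_mul_integrable => //; first exact: measurable_phase.
by move=> x; exact: cos_max.
Qed.

Lemma wave_bounded (R : realType) (u : R -> R) : rschwartz u ->
  exists2 C, 0 <= C & forall xi k phi, `|wave u xi k phi| <= C.
Proof.
move=> su; have [M M0 uM] := rschwartz_decay su.
exists (M * pi) => [|xi k phi]; first by rewrite mulr_ge0// pi_ge0.
have iM : mu.-integrable setT (EFin \o (fun x : R => M * (1 / (1 ^+ 2 + (x - 0) ^+ 2)))).
  by apply: integrable_scale => //; exact: integrable_cauchy.
have iw := wave_integrable xi k phi su.
rewrite (le_trans (le_normr_Rintegral _ iw))//.
rewrite -(@Rintegral_cauchy _ 1 0)// -RintegralZl//; last exact: integrable_cauchy.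
apply: le_Rintegral => //; first exact: integrable_norm.
by move=> x _; rewrite normrM (le_trans _ (uM x))// ler_piMr// cos_max.
Qed.

(** Differentiation becomes multiplication by [i k], that is a phase shift of
    [pi / 2] and a factor [k]; the boundary terms vanish by [rschwartz_decay]. *)
Lemma wave_derive1 (R : realType) (u : R -> R) (xi k phi : R) : rschwartz u ->
  wave (derive1 u) xi k (phi + pi / 2) = - (k * wave u xi k phi).
Proof.
move=> su; have su' := rschwartz_derive1 su.
have [M M0 uM] := rschwartz_decay su.
pose psi x := phi + pi / 2 + k * (xi - x).
pose F x := u x * cos (psi x).
pose f x := derive1 u x * cos (psi x) + k * (u x * cos (phi + k * (xi - x))).
(* [f] is the derivative of [F] *)
have E : Rintegral mu setT f = 0.
  apply: (Rintegral_derive (F := F) _ (exhausts_setT R)) => //.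
  - move=> x _; have ux := rschwartz_is_derive su x.
    apply: is_derive_eq.
    rewrite /f /GRing.scale /=.
    rewrite (_ : phi + k * (xi - x) = psi x - pi / 2) ?cosBpihalf; first by ring.
    by rewrite /psi; lra.
  - move=> x _; have ux := rschwartz_is_derive su x.
    have ux' := rschwartz_is_derive su' x.
    exact: is_derive_continuous.
  - apply: integrable_add => //; first exact: wave_integrable.
    by apply: integrable_scale => //; exact: wave_integrable.
  - apply: (@cvg_harmonic_bound _ (M + M)) => n.
    have HF x : `|x| = n.+1%:R -> `|F x| <= M / n.+1%:R.
      move=> xn; rewrite normrM (@le_trans _ _ `|u x|)// ?ler_piMr ?cos_max//.
      rewrite (le_trans (uM x))// ler_wpM2l// subr0 div1r expr1n.
      rewrite lef_pV2 ?posrE ?ltr_pwDl ?sqr_ge0// -real_normK ?num_real// xn.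
      by rewrite (@le_trans _ _ (n.+1%:R ^+ 2))// ?lerDr// -natrX ler_nat leq_pmulr.
    rewrite (le_trans (ler_normB _ _))// mulrDl lerD// HF//.
      by rewrite ger0_norm.
    by rewrite normrN ger0_norm.
move: E; rewrite /f RintegralD//; first last.
- by apply: integrable_scale => //; exact: wave_integrable.
- exact: wave_integrable.
rewrite RintegralZl//; last exact: wave_integrable.
by move=> /eqP; rewrite addr_eq0 => /eqP.
Qed.

Lemma wave_decay (R : realType) (u : R -> R) (j : nat) : rschwartz u ->
  exists2 C, 0 <= C & forall xi k phi, `|k| ^+ j * `|wave u xi k phi| <= C.
Proof.
elim: j u => [|j IH] u su.
  have [C C0 HC] := wave_bounded su; exists C => // xi k phi.
  by rewrite expr0 mul1r.
have [C C0 HC] := IH _ (rschwartz_derive1 su).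
exists C => // xi k phi; rewrite exprSr -mulrA -normrM.
by rewrite -[`|k * _|]normrN -wave_derive1.
Qed.

(** The factor [1 + `|k|] leaves room both for the symbol [`|k| `^ a] and for the
    bound [`|k| * y] on [1 - e^(- i k y)]. *)
Lemma wave_weighted_decay (R : realType) (u : R -> R) : rschwartz u ->
  exists2 C, 0 <= C & forall xi k phi,
    (1 + `|k|) * `|wave u xi k phi| <= C * (1 / (1 ^+ 2 + (k - 0) ^+ 2)).
Proof.
move=> su.
have [C0 ? H0] := wave_decay 0 su; have [C1 ? H1] := wave_decay 1 su.
have [C2 ? H2] := wave_decay 2 su; have [C3 ? H3] := wave_decay 3 su.
exists (C0 + C1 + C2 + C3) => [|xi k phi]; first by rewrite !addr_ge0.
rewrite subr0 expr1n div1r ler_pdivlMr ?ltr_pwDl ?sqr_ge0//.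
have := H0 xi k phi; have := H1 xi k phi; have := H2 xi k phi; have := H3 xi k phi.
rewrite -[k ^+ 2]real_normK ?num_real//.
set a := `|k|; set b := `|wave _ _ _ _|; lra.
Qed.

(** The quadratures 0 and [pi / 2] determine all phases. *)
Lemma wave_phase (R : realType) (u : R -> R) (xi k phi : R) : rschwartz u ->
  wave u xi k phi =
  cos phi * wave u xi k 0 + sin phi * wave u xi k (pi / 2).
Proof.
move=> su; rewrite /wave -!RintegralZl//; try exact: wave_integrable.
rewrite -RintegralD//;
  try by apply: integrable_scale => //; exact: wave_integrable.
apply: eq_Rintegral => x _.
rewrite add0r [pi / 2 + _]addrC cosDpihalf cosD; ring.
Qed.

Lemma wave_continuous (R : realType) (u : R -> R) (xi phi : R) : rschwartz u ->
  continuous (fun k => wave u xi k phi).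
Proof.
move=> su k.
have iu : mu.-integrable setT (EFin \o (fun x => `|u x|)).
  apply: integrable_norm; have := wave_integrable 0 0 0 su.
  by apply: eq_integrable => // x _ /=; rewrite mul0r addr0 cos0 mulr1.
apply: (@continuity_under_integral R _ _ mu
  (fun k x => u x * cos (phi + k * (xi - x))) setT _ (k - 1) (k + 1) _ _
  (fun x => `|u x|)) => //.
- by move=> l _; exact: wave_integrable.
- apply: aeW => x _ l _.
  by apply: is_derive_continuous.
- by move=> l _; apply: aeW => x _; rewrite normrM ler_piMr// cos_max.
- by rewrite inE /= in_itv/=; apply/andP; split; lra.
Qed.

Lemma wave_measurable (R : realType) (u : R -> R) (xi phi : R) : rschwartz u ->
  measurable_fun setT (fun k => wave u xi k phi).
Proof. by move=> su; apply: continuous_measurable_fun; exact: wave_continuous. Qed.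

Lemma wave_integrable_freq (R : realType) (u : R -> R) (xi phi : R) :
  rschwartz u -> mu.-integrable setT (EFin \o (fun k => wave u xi k phi)).
Proof.
move=> su; have [C C0 HC] := wave_weighted_decay su.
apply: (@integrable_dominated _ _ _
  (fun x => C * (1 / (1 ^+ 2 + (x - 0) ^+ 2)))) => //.
- exact: wave_measurable.
- by apply: integrable_scale => //; exact: integrable_cauchy.
- by move=> k _; rewrite (le_trans _ (HC xi k phi))// ler_peMl// lerDl.
Qed.

(** * Abel means and the Poisson kernel *)

(** From [1 + t ^ 2 / 2 <= e ^ t]. *)
Lemma abel_weight_le (R : realType) (e k : R) : 0 < e ->
  expR (- (e * `|k|)) <= 2 / e * (e^-1 / (e^-1 ^+ 2 + (k - 0) ^+ 2)).
Proof.
move=> e0; rewrite subr0 expRN -[k ^+ 2]real_normK ?num_real//.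
set t := `|k|; have t0 : 0 <= t by exact: normr_ge0.
have := @expR_ge1Dxn _ (e * t) 1 (mulr_ge0 (ltW e0) t0).
rewrite (_ : 2 / e * _ = ((1 + (e * t) ^+ 2) / 2)^-1); last first.
  by field; rewrite !gt_eqF//; nra.
move=> h; rewrite lef_pV2 ?posrE ?expR_gt0//; last by nra.
by apply: le_trans h; rewrite (_ : 2`! = 2)%N //; nra.
Qed.

Lemma abel_weight_measurable (R : realType) (e : R) :
  measurable_fun [set: R] (fun k => expR (- (e * `|k|))).
Proof.
apply: (@measurableT_comp _ _ _ _ _ _ expR) => //.
apply: measurable_funN; apply: measurable_funM => //.
Qed.

Lemma abel_weight_integrable (R : realType) (e : R) : 0 < e ->
  mu.-integrable [set: R] (EFin \o (fun k => expR (- (e * `|k|)))).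
Proof.
move=> e0; apply: (@integrable_dominated _ _ _
  (fun k => 2 / e * (e^-1 / (e^-1 ^+ 2 + (k - 0) ^+ 2)))) => //.
- exact: abel_weight_measurable.
- by apply: integrable_scale => //; apply: integrable_cauchy; rewrite invr_gt0.
- by move=> k _; rewrite ger0_norm ?expR_ge0// abel_weight_le.
Qed.

Lemma abel_integrable (R : realType) (e phi z : R) : 0 < e ->
  mu.-integrable [set: R]
    (EFin \o (fun k => expR (- (e * `|k|)) * cos (phi + k * z))).
Proof.
move=> e0; apply: (@integrable_dominated _ _ _ (fun k => expR (- (e * `|k|)))) => //.
- apply: measurable_funM; first exact: abel_weight_measurable.
  exact: measurable_derivable.
- exact: abel_weight_integrable.
- by move=> k _; rewrite normrM ger0_norm ?expR_ge0// ler_piMr ?expR_ge0// cos_max.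
Qed.

Lemma Rintegral_reflect (R : realType) (f : R -> R) :
  measurable_fun setT f ->
  mu.-integrable `[0, +oo[%classic (EFin \o (fun x => f (- x))) ->
  Rintegral mu `]-oo, 0] f = Rintegral mu `[0, +oo[ (fun x => f (- x)).
Proof.
move=> mf intf; congr fine.
have E : `[0, +oo[%classic = (-%R : R -> R) @^-1` `]-oo, 0]%classic.
  by apply/seteqP; split => x; rewrite /= !in_itv/= andbT oppr_le0.
rewrite E in intf *.
pose opp := (-%R : R -> R) : measurableTypeR R -> measurableTypeR R.
have mopp : measurable_fun setT opp by exact: oppr_measurable.
rewrite -(@integral_pushforward _ _ _ _ R opp mopp mu _ (EFin \o f))//.
- apply: eq_measure_integral => //= A mA AS; exact/esym/lebesgue_measureN.
- by apply/measurable_EFinP; exact: mf.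
Qed.

Lemma abel_half_line (R : realType) (e phi z : R) : 0 < e ->
  Rintegral mu `[0, +oo[ (fun k => expR (- (e * k)) * cos (phi + k * z)) =
  (e * cos phi - z * sin phi) / (e ^+ 2 + z ^+ 2).
Proof.
move=> e0.
have D0 := cauchy_den_gt0 z e0.
have Di : 0 <= (e ^+ 2 + z ^+ 2)^-1 by rewrite invr_ge0 ltW.
(* the real part of [e^(i phi) * e^((i z - e) k) / (i z - e)] *)
pose F k := expR (- (e * k)) * (z * sin (phi + k * z) - e * cos (phi + k * z))
            / (e ^+ 2 + z ^+ 2).
apply: (Rintegral_derive (F := F) _ (exhausts_cy 0)) => //.
- move=> x _; apply: is_derive_eq.
  rewrite /GRing.scale /=; field; lra.
- by move=> x _; apply: is_derive_continuous.
- have := integrable_itv `[0, +oo[ (abel_integrable phi z e0).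
  apply: eq_integrable => // k; rewrite inE /= in_itv/= andbT => k0.
  by rewrite ger0_norm.
- rewrite -[X in _ --> X](add0r) -[X in _ --> 0 + X]opprK.
  apply: cvgB; last first.
    rewrite [X in _ --> X](_ : _ = F 0); first exact: cvg_cst.
    by rewrite /F mulr0 oppr0 expR0 mul0r addr0; lra.
  apply: (@cvg_harmonic_bound _ ((`|z| + e) / (e ^+ 2 + z ^+ 2) / e)) => n.
  rewrite /F add0r !normrM (ger0_norm Di).
  rewrite ger0_norm ?expR_ge0//.
  rewrite (_ : _ / e / _ = (e * n.+1%:R)^-1 * (`|z| + e) / (e ^+ 2 + z ^+ 2)); last first.
    by field; rewrite !gt_eqF//.
  rewrite (ler_wpM2r Di)//; apply: ler_pM => //.
    rewrite expRN lef_pV2 ?posrE ?expR_gt0 ?mulr_gt0//.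
    by apply: le_trans (expR_ge1Dx _); rewrite lerDr.
  rewrite (le_trans (ler_normB _ _))// !normrM (ger0_norm (ltW e0)).
  by rewrite lerD// ?ler_piMr ?sin_max ?cos_max// ltW.
Qed.

(** The odd part of [cos (phi + k * z)] in [k] integrates to 0; the even part gives
    the Poisson kernel. *)
Lemma abel_kernel (R : realType) (e phi z : R) : 0 < e ->
  Rintegral mu setT (fun k => expR (- (e * `|k|)) * cos (phi + k * z)) =
  2 * cos phi * (e / (e ^+ 2 + z ^+ 2)).
Proof.
move=> e0.
have iT := abel_integrable phi z e0.
have DU : [set: R] = `]-oo, 0]%classic `|` `]0, +oo[%classic.
  apply/seteqP; split => // x _ /=; rewrite !in_itv/= andbT.
  by case: (lerP x 0); [left|right].
rewrite DU Rintegral_setU//; first last.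
- apply/disj_setPS => x [/=]; rewrite !in_itv/= andbT => x0 /lt_geF.
  by rewrite x0.
- by rewrite -DU.
rewrite Rintegral_itv_obnd_cbnd; last exact: integrable_itv iT.
rewrite Rintegral_reflect; first last.
- have := integrable_itv `[0, +oo[ (abel_integrable phi (- z) e0).
  apply: eq_integrable => // k _ /=.
  by rewrite normrN mulrN mulNr.
- by apply/measurable_EFinP; exact: measurable_int iT.
have E y : y = z \/ y = - z ->
    Rintegral mu `[0, +oo[ (fun k => expR (- (e * `|k|)) * cos (phi + k * y)) =
    (e * cos phi - y * sin phi) / (e ^+ 2 + z ^+ 2).
  move=> yz; have -> : z ^+ 2 = y ^+ 2 by case: yz => ->; rewrite ?sqrrN.
  rewrite -abel_half_line//; apply: eq_Rintegral => k.
  by rewrite inE /= in_itv/= andbT => k0; rewrite ger0_norm.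
under [X in X + _]eq_Rintegral do rewrite normrN mulNr -mulrN.
rewrite E; last by right.
by rewrite E; [lra|left].
Qed.

(** * Fourier inversion *)

(** Since the kernel has integral [pi], it is enough to integrate
    [(u x - u xi) * P n x].  Near [xi] the Lipschitz bound compensates the
    concentration of the kernel, far away the bound on [u] and [e <= 1] suffice;
    this yields an integrable bound that does not depend on [n], and no change of
    variables is needed. *)
Lemma poisson_approximation (R : realType) (u : R -> R) (xi M L : R) :
  measurable_fun setT u -> (forall x, `|u x| <= M) ->
  (forall x y, `|u x - u y| <= L * `|x - y|) ->
  Rintegral mu setT (fun x => u x * (n.+1%:R^-1 /
    (n.+1%:R^-1 ^+ 2 + (x - xi) ^+ 2))) @[n --> \oo] --> pi * u xi.
Proof.
move=> mu_ uM uL.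
have L0 : 0 <= L.
  by have := uL 1 0; rewrite subr0 normr1 mulr1; exact: le_trans.
pose P n x : R := n.+1%:R^-1 / (n.+1%:R^-1 ^+ 2 + (x - xi) ^+ 2).
have e0 n : 0 < n.+1%:R^-1 :> R by rewrite invr_gt0.
have e1 n : n.+1%:R^-1 <= 1 :> R by rewrite invf_le1// ler1n.
have P0 n x : 0 <= P n x by rewrite divr_ge0// ltW// cauchy_den_gt0.
have iP n : mu.-integrable setT (EFin \o P n) by exact: integrable_cauchy.
have mP n : measurable_fun setT (P n) by exact: measurable_cauchy.
have iuP n : mu.-integrable setT (EFin \o (fun x => u x * P n x)).
  apply: (@integrable_dominated _ _ _ (fun x => M * P n x)) => //.
  - exact: measurable_funM.
  - exact: integrable_scale.
  - by move=> x _; rewrite normrM (ger0_norm (P0 _ _)) ler_wpM2r.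
have [] := @Rintegral_dominated_cvg R setT
  (fun n x => (u x - u xi) * P n x) (fun=> 0)
  (fun x => (L + 2 * M) * (1 / (1 ^+ 2 + (x - xi) ^+ 2))) measurableT.
- move=> n; apply: measurable_funM => //; exact: measurable_funB.
- move=> x _; apply: (@cvg_harmonic_bound _ (`|u x - u xi| / (x - xi) ^+ 2)) => n.
  rewrite normrM (ger0_norm (P0 _ _)).
  have [->|xxi] := eqVneq x xi; first by rewrite !subrr normr0 !mul0r.
  rewrite -mulrA ler_wpM2l// mulrC /P ler_wpM2l ?(ltW (e0 _))//.
  rewrite lef_pV2 ?posrE ?cauchy_den_gt0//; last first.
    by rewrite exprn_even_gt0//= subr_eq0.
  by rewrite lerDr sqr_ge0.
- by apply: integrable_scale => //; exact: integrable_cauchy.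
- move=> n x _; rewrite normrM (ger0_norm (P0 _ _)) /P expr1n.
  have := e0 n; have := e1 n; set e := n.+1%:R^-1 => e_le1 e_gt0.
  rewrite mulrA ler_pdivrMr ?cauchy_den_gt0// mul1r mulrAC ler_pdivlMr; last first.
    by rewrite ltr_pwDl ?sqr_ge0.
  have := uL x xi.
  have : `|u x - u xi| <= 2 * M.
    by rewrite (le_trans (ler_normB _ _))// mulr2n mulrDl mul1r lerD.
  rewrite -[(x - xi) ^+ 2]real_normK ?num_real//.
  have := normr_ge0 (x - xi); have := normr_ge0 (u x - u xi).
  set d := `|u x - u xi|; set z := `|x - xi| => d0 z0 dM dL.
  have M0 : 0 <= M by lra.
  (* [e z <= e ^ 2 + z ^ 2] near the center, [e <= 1] away from it *)
  have h1 : d * e <= L * (e ^+ 2 + z ^+ 2).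
    apply: (@le_trans _ _ (L * z * e)); first by rewrite ler_wpM2r// ltW.
    by rewrite -mulrA ler_wpM2l//; nra.
  have h2 : d * e * z ^+ 2 <= 2 * M * (e ^+ 2 + z ^+ 2).
    apply: (@le_trans _ _ (2 * M * z ^+ 2)); last by rewrite ler_wpM2l ?lerDr ?sqr_ge0//; lra.
    by rewrite ler_wpM2r ?sqr_ge0// (le_trans _ dM)// ler_piMr.
  by rewrite mulrDr mulr1 mulrDl lerD.
move=> _; rewrite Rintegral_cst// mul0r => H.
have E n : Rintegral mu setT (fun x => u x * P n x) =
    Rintegral mu setT (fun x => (u x - u xi) * P n x) + pi * u xi.
  rewrite mulrC -(@Rintegral_cauchy R n.+1%:R^-1 xi)// -RintegralZl//.
  rewrite -RintegralD//.
  - by apply: eq_Rintegral => x _; rewrite /P; ring.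
  - have := integrable_sub measurableT (iuP n) (integrable_scale (u xi) measurableT (iP n)).
    by apply: eq_integrable => // x _ /=; rewrite mulrBl.
  - exact: (integrable_scale (u xi) measurableT (iP n)).
  - exact: iP.
suff : Rintegral mu setT (fun x => u x * P n x) @[n --> \oo] --> pi * u xi by [].
rewrite (funext E) -[X in _ --> X]add0r.
by apply: cvgD => //; exact: cvg_cst.
Qed.

Lemma measurable_phase2 (R : realType) (xi phi : R) :
  measurable_fun [set: R * R] (fun p => cos (phi + p.2 * (xi - p.1))).
Proof.
apply: (@measurableT_comp _ _ _ _ _ _ cos); first exact: measurable_derivable.
apply: measurable_funD => //; apply: measurable_funM; first exact: measurable_snd.
by apply: measurable_funB => //; exact: measurable_fst.
Qed.

(** With the weight [expR (- (e * `|k|))] the double integral over frequencies and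
    positions converges absolutely, so the frequency integral may be taken first. *)
Lemma abel_mean_wave (R : realType) (u : R -> R) (e xi phi : R) :
  0 < e -> rschwartz u ->
  Rintegral mu setT (fun k => expR (- (e * `|k|)) * wave u xi k phi) =
  2 * cos phi * Rintegral mu setT (fun x => u x * (e / (e ^+ 2 + (x - xi) ^+ 2))).
Proof.
move=> e0 su.
have iuP : mu.-integrable setT (EFin \o
    (fun x => u x * (e / (e ^+ 2 + (x - xi) ^+ 2)))).
  have [M' M'0 uM'] := rschwartz_bounded su.
  have P0 x : 0 <= e / (e ^+ 2 + (x - xi) ^+ 2).
    exact: divr_ge0 (ltW e0) (ltW (cauchy_den_gt0 _ e0)).
  apply: (@integrable_dominated _ _ _ (fun x => M' * (e / (e ^+ 2 + (x - xi) ^+ 2)))) => //.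
  - apply: measurable_funM; first exact: rschwartz_measurable.
    exact: measurable_cauchy.
  - by apply: integrable_scale => //; exact: integrable_cauchy.
  - by move=> x _; rewrite normrM (ger0_norm (P0 x)) ler_wpM2r.
have [M M0 uM] := rschwartz_decay su.
have [||||_ _ swap] := @Rintegral_swap R setT setT
  (fun x k => u x * cos (phi + k * (xi - x)) * expR (- (e * `|k|)))
  (fun x => M * (1 / (1 ^+ 2 + (x - 0) ^+ 2)))
  (fun k => expR (- (e * `|k|))) measurableT measurableT.
- apply: measurable_funM.
    apply: measurable_funM; last exact: measurable_phase2.
    exact: (measurableT_comp (rschwartz_measurable su) measurable_fst).
  exact: (measurableT_comp (abel_weight_measurable e) measurable_snd).
- by apply: integrable_scale => //; exact: integrable_cauchy.
- exact: abel_weight_integrable.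
- move=> x k _ _; rewrite normrM (ger0_norm (expR_ge0 _)) ler_wpM2r ?expR_ge0//.
  by rewrite normrM (le_trans _ (uM x))// ler_piMr// cos_max.
transitivity (Rintegral mu setT (fun k => Rintegral mu setT
    (fun x => u x * cos (phi + k * (xi - x)) * expR (- (e * `|k|))))).
  apply: eq_Rintegral => k _.
  rewrite mulrC; symmetry; apply: RintegralZr; first exact: measurableT.
  exact: wave_integrable.
transitivity (Rintegral mu setT (fun x => Rintegral mu setT
    (fun k => u x * cos (phi + k * (xi - x)) * expR (- (e * `|k|))))).
  exact: esym swap.
clear swap.
have Z := RintegralZl (2 * cos phi) measurableT iuP; rewrite -[RHS]Z {Z}.
apply: eq_Rintegral => x _.
transitivity (u x * Rintegral mu setT
    (fun k => expR (- (e * `|k|)) * cos (phi + k * (xi - x)))).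
  have ia := abel_integrable phi (xi - x) e0.
  have Z := RintegralZl (u x) measurableT ia; rewrite -[RHS]Z {Z}.
  by apply: eq_Rintegral => k _; ring.
by rewrite abel_kernel// -(sqrrN (xi - x)) opprB; ring.
Qed.

(** Fourier inversion: Abel means of the frequency integral converge to it by
    dominated convergence, and to the right-hand side by
    [poisson_approximation]. *)
Lemma wave_inversion (R : realType) (u : R -> R) (xi phi : R) : rschwartz u ->
  Rintegral mu setT (fun k => wave u xi k phi) = 2 * pi * (cos phi * u xi).
Proof.
move=> su.
pose e n : R := n.+1%:R^-1.
have e0 n : 0 < e n by rewrite invr_gt0.
pose A n := Rintegral mu setT (fun k => expR (- (e n * `|k|)) * wave u xi k phi).
have A1 : A n @[n --> \oo] --> Rintegral mu setT (fun k => wave u xi k phi).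
  apply: (Rintegral_dominated_cvg (g := fun k => `|wave u xi k phi|) _ _ _ _ _).2 => //.
  - move=> n; apply: measurable_funM; first exact: abel_weight_measurable.
    exact: wave_measurable.
  - move=> k _; rewrite -[X in _ --> X]mul1r; apply: cvgMr_tmp.
    rewrite -expR0 -[in X in _ --> X]oppr0 -(mul0r `|k|).
    apply: continuous_cvg; first exact: continuous_expR.
    by apply: cvgN; apply: cvgMr_tmp; exact: cvg_harmonic.
  - by apply: integrable_norm; exact: wave_integrable_freq.
  - move=> n k _; rewrite normrM ger0_norm ?expR_ge0// ler_piMl//.
    by rewrite expR_le1 oppr_le0 mulr_ge0// ltW.
apply: (cvg_unique _ A1) => //.
have -> : A = fun n => 2 * cos phi * Rintegral mu setT (fun x => u x *
    (n.+1%:R^-1 / (n.+1%:R^-1 ^+ 2 + (x - xi) ^+ 2))).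
  by apply/funext => n; exact: abel_mean_wave.
have [M M0 uM] := rschwartz_bounded su.
have [L L0 uL] := rschwartz_bounded (rschwartz_derive1 su).
rewrite (_ : 2 * pi * _ = 2 * cos phi * (pi * u xi)); last by ring.
apply: cvgMl_tmp; apply: (poisson_approximation (M := M) (L := L)) => //.
- exact: rschwartz_measurable.
- exact: lipschitz_derive (rschwartz_is_derive su) uL.
Qed.

(** * The weight in the increment variable *)

Lemma powRN1D (R : realType) (a y : R) : 0 < y ->
  y `^ (- a) = y / y `^ (1 + a).
Proof.
move=> y0; rewrite powRD; last by rewrite (@gt_eqF _ _ y) ?implybT.
by rewrite powRr1 ?ltW// powRN invfM mulrA divff ?gt_eqF// mul1r.
Qed.

Lemma is_derive_powR_inv (R : realType) (a y : R) : 0 < y ->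
  is_derive y 1 (fun t => t `^ (- a)) (- a / y `^ (1 + a)).
Proof.
move=> y0; have := is_derive1_powR (- a) y0.
by rewrite (_ : - a - 1 = - (1 + a)) ?powRN//; lra.
Qed.

(** Up to constants, this is the bound for every integral in the increment [y]:
    the numerators are bounded at infinity and [O(y)] at 0. *)
Definition power_weight (R : realType) (a y : R) : R :=
  Num.min 1 y / y `^ (1 + a).

Lemma measurable_powR_div (R : realType) (a : R) (f : R -> R) :
  measurable_fun setT f -> measurable_fun setT (fun y => f y / y `^ (1 + a)).
Proof.
move=> mf; apply: measurable_funM => //.
under eq_fun do rewrite -powRN.
exact: measurable_powR.
Qed.

Lemma integrable_power_weight (R : realType) (a : R) : 0 < a < 1 ->
  mu.-integrable `]0, +oo[ (EFin \o power_weight a).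
Proof.
move=> /andP[a0 a1].
(* [min 1 y / y ^ (1 + a)] is [y ^ (- a)] up to 1 and [1 / y ^ (1 + a)] after 1 *)
have i0 : mu.-integrable `]0, 1] (EFin \o (fun y : R => y `^ (- a))).
  apply: (integrable_derive (F := fun y => y `^ (1 - a) / (1 - a))
    (M := (1 - a)^-1) _ _ (exhausts_0c ltr01)) => //.
  - by apply: measurable_funTS; exact: measurable_powR.
  - move=> x; rewrite /= in_itv/= => /andP[x0 _].
    have := is_derive1_powR (1 - a) x0.
    rewrite (_ : 1 - a - 1 = - a); last by lra.
    move=> dx; apply: is_derive_eq; rewrite /GRing.scale /=; field; lra.
  - move=> x; rewrite /= in_itv/= => /andP[x0 _].
    exact: is_derive_continuous (is_derive_powR_inv a x0).
  - by move=> x _; exact: powR_ge0.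
  - move=> x; rewrite /= in_itv/= => /andP[x0 x1].
    have ia : 0 <= (1 - a)^-1 by rewrite invr_ge0; lra.
    rewrite normrM (ger0_norm (powR_ge0 _ _)) (ger0_norm ia) ler_piMl//.
    have : x `^ (1 - a) <= 1 `^ (1 - a).
      by apply: ge0_ler_powR; rewrite ?nnegrE//; lra.
    by rewrite powR1.
have i1 : mu.-integrable `[1, +oo[ (EFin \o (fun y : R => 1 / y `^ (1 + a))).
  apply: (integrable_derive (F := fun y => - (y `^ (- a) / a))
    (M := a^-1) _ _ (exhausts_cy 1)) => //.
  - by apply: measurable_funTS; exact: measurable_powR_div.
  - move=> x; rewrite /= in_itv/= andbT => x1.
    have x0 := lt_le_trans ltr01 x1.
    have dx := is_derive_powR_inv a x0.
    apply: is_derive_eq; rewrite /GRing.scale /=; field.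
    by rewrite !gt_eqF ?powR_gt0.
  - move=> x; rewrite /= in_itv/= andbT => x1.
    have x0 := lt_le_trans ltr01 x1.
    apply: cvgM; first exact: cvg_cst.
    apply: cvgV; first by rewrite gt_eqF// powR_gt0.
    exact: is_derive_continuous (is_derive1_powR (1 + a) x0).
  - by move=> x _; rewrite divr_ge0// powR_ge0.
  - move=> x; rewrite /= in_itv/= andbT => x1.
    have x0 := lt_le_trans ltr01 x1.
    have ia : 0 <= a^-1 by rewrite invr_ge0 ltW.
    rewrite normrN normrM (ger0_norm (powR_ge0 _ _)) (ger0_norm ia) ler_piMl//.
    rewrite powRN invf_le1 ?powR_gt0//.
    by rewrite -[leLHS](powRr0 x) ler_powR// ltW.
have h0 := (integrable_patch _ (measurable_itv _)).1 i0.
have h1 := (integrable_patch _ (measurable_itv _)).1 i1.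
have h := integrable_itv `]0, +oo[ (integrable_add measurableT h0 h1).
apply: integrable_dominated h _ => //.
  apply: measurable_funTS; apply: measurable_powR_div.
  exact: measurable_minr.
move=> y; rewrite /= in_itv/= andbT => y0; rewrite /power_weight.
rewrite ger0_norm; last by rewrite divr_ge0 ?powR_ge0// le_min ler01 ltW.
rewrite !patchE; case: (lerP y 1) => y1.
  rewrite mem_set/=; last by rewrite in_itv/= y0.
  rewrite powRN1D// lerDl; case: ifP => // _.
  by rewrite divr_ge0// powR_ge0.
have -> : (y \in `[1, +oo[%classic) = true by apply: mem_set; rewrite /= in_itv/= ltW.
have -> : (y \in `]0, 1]%classic) = false.
  by apply: memNset => /=; rewrite in_itv/= => /andP[_]; rewrite leNgt y1.
by rewrite add0r.
Qed.

(** * Integration by parts for damped oscillations *)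

(** This is the real part of [e^(i th) * (1 - e^(- s y))] for [s = p + i q], and
    [damped_slope] is its derivative in [y], the real part of
    [e^(i th) * s * e^(- s y)]. *)
Definition damped (R : realType) (p q th y : R) : R :=
  cos th - expR (- (p * y)) * cos (th - q * y).

Definition damped_slope (R : realType) (p q th y : R) : R :=
  expR (- (p * y)) * (p * cos (th - q * y) - q * sin (th - q * y)).

Lemma is_derive_damped (R : realType) (p q th y : R) :
  is_derive y 1 (damped p q th) (damped_slope p q th y).
Proof.
by apply: is_derive_eq; rewrite /damped_slope /GRing.scale /=; ring.
Qed.

Lemma damped_measurable (R : realType) (p q th : R) :
  measurable_fun setT (damped p q th).
Proof. exact: measurable_derivable (is_derive_damped p q th). Qed.

Lemma expRN_le1 (R : realType) (t : R) : 0 <= t -> expR (- t) <= 1.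
Proof. by move=> t0; rewrite expR_le1 oppr_le0. Qed.

Lemma damped_le (R : realType) (p q th y : R) : 0 <= p -> 0 <= y ->
  `|damped p q th y| <= (2 + p + `|q|) * Num.min 1 y.
Proof.
move=> p0 y0.
have E1 := expRN_le1 (mulr_ge0 p0 y0); have E0 := expR_ge0 (- (p * y)).
have c1 t := cos_max (t : R).
have h2 : `|damped p q th y| <= 2.
  rewrite /damped (le_trans (ler_normB _ _))// normrM (ger0_norm E0).
  by rewrite (_ : 2 = 1 + 1)// lerD ?c1// mulr_ile1.
have hy : `|damped p q th y| <= (p + `|q|) * y.
  have -> : damped p q th y = (cos th - cos (th - q * y)) +
      (1 - expR (- (p * y))) * cos (th - q * y) by rewrite /damped; ring.
  rewrite (le_trans (ler_normD _ _))// [leLHS]addrC [leRHS]mulrDl lerD//.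
    rewrite normrM (@le_trans _ _ `|1 - expR (- (p * y))|)// ?ler_piMr//.
    rewrite ger0_norm ?subr_ge0//; have := expR_ge1Dx (- (p * y)); lra.
  rewrite (le_trans (cos_lipschitz _ _))// opprB addrC subrK normrM.
  by rewrite (ger0_norm y0).
have q0 := normr_ge0 q.
case: (lerP 1 y) => y1; nra.
Qed.

Lemma expR_weight_le (R : realType) (p y : R) : 0 < p -> 0 <= y ->
  y * expR (- (p * y)) <= (1 + p^-1) * Num.min 1 y.
Proof.
move=> p0 y0.
have ip : 0 < p^-1 by rewrite invr_gt0.
have E1 := expRN_le1 (mulr_ge0 (ltW p0) y0); have E0 := expR_ge0 (- (p * y)).
case: (lerP 1 y) => y1; last by nra.
have : y * expR (- (p * y)) <= p^-1.
  rewrite -[leRHS]mulr1 -ler_pdivrMl ?invr_gt0// invrK mulrA.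
  rewrite -(expRxMexpNx_1 (p * y)) ler_wpM2r//.
  by apply: le_trans (expR_ge1Dx _); rewrite lerDr.
lra.
Qed.

Lemma damped_slope_le (R : realType) (p q th y : R) : 0 < p -> 0 <= y ->
  `|y * damped_slope p q th y| <= (p + `|q|) * (1 + p^-1) * Num.min 1 y.
Proof.
move=> p0 y0; rewrite /damped_slope mulrA normrM.
rewrite [`|y * _|]ger0_norm ?mulr_ge0 ?expR_ge0// mulrC -mulrA.
apply: ler_pM => //; first by rewrite mulr_ge0 ?expR_ge0.
  rewrite (le_trans (ler_normB _ _))// !normrM (gtr0_norm p0).
  by rewrite lerD// ler_piMr ?cos_max ?sin_max// ltW.
exact: expR_weight_le.
Qed.

Lemma le_power_weight (R : realType) (a K : R) (f : R -> R) : 0 < a < 1 ->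
  measurable_fun setT f ->
  (forall y, 0 <= y -> `|f y| <= K * Num.min 1 y) ->
  mu.-integrable `]0, +oo[ (EFin \o (fun y => f y / y `^ (1 + a))).
Proof.
move=> a01 mf fK.
apply: integrable_dominated (integrable_scale K _ (integrable_power_weight a01)) _ => //.
  by apply: measurable_funTS; exact: measurable_powR_div.
move=> y; rewrite /= in_itv/= andbT => y0.
rewrite normrM [`|_^-1|]ger0_norm ?invr_ge0 ?powR_ge0// mulrA ler_wpM2r//.
  by rewrite invr_ge0 powR_ge0.
by rewrite fK// ltW.
Qed.

Lemma damped_integrable (R : realType) (a p q th : R) : 0 < a < 1 -> 0 <= p ->
  mu.-integrable `]0, +oo[ (EFin \o (fun y => damped p q th y / y `^ (1 + a))).
Proof.
move=> a01 p0; apply: le_power_weight => //; first exact: damped_measurable.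
by move=> y y0; exact: damped_le.
Qed.

Lemma damped_slope_measurable (R : realType) (p q th : R) :
  measurable_fun setT (damped_slope p q th).
Proof. exact: measurable_derivable. Qed.

Lemma damped_slope_integrable (R : realType) (a p q th : R) : 0 < a < 1 -> 0 < p ->
  mu.-integrable `]0, +oo[
    (EFin \o (fun y => y * damped_slope p q th y / y `^ (1 + a))).
Proof.
move=> a01 p0; apply: (@le_power_weight _ _ _ (fun y => y * damped_slope p q th y)) => //.
  by apply: measurable_funM => //; exact: damped_slope_measurable.
by move=> y y0; exact: damped_slope_le.
Qed.

Lemma powR_invN (R : realType) (x b : R) : 0 <= x -> x^-1 `^ b = x `^ (- b).
Proof. by move=> x0; rewrite -powR_inv1// -powRrM mulN1r. Qed.

Lemma cvg_powR_natN (R : realType) (b : R) : 0 < b ->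
  (n.+2%:R `^ (- b) : R) @[n --> \oo] --> 0.
Proof.
move=> b0.
have E (n : nat) : n.+2%:R `^ (- b) = n.+2%:R^-1 `^ b :> R by rewrite powR_invN.
rewrite (funext E).
apply: (cvg_at_rightP (fun x => x `^ b) 0 0).1; first exact: powR_cvg0.
split=> [n|]; first by rewrite invr_gt0.
apply: (@cvg_harmonic_bound _ 1) => n.
by rewrite ger0_norm ?invr_ge0// div1r lef_pV2 ?posrE// ler_nat.
Qed.

(** The integrand is the derivative of [damped p q th y * y `^ (- a)], which tends to
    0 at infinity because [0 < a] and at 0 because [a < 1].  For [p > 0] and all
    [th] this says that [s * Phi' s = a * Phi s], where [Phi s] is the integral of
    [(1 - e^(- s y)) / y ^ (1 + a)]. *)
Lemma Rintegral_damped_by_parts (R : realType) (a p q th : R) :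
  0 < a < 1 -> 0 < p ->
  Rintegral mu `]0, +oo[
    (fun y => y * damped_slope p q th y / y `^ (1 + a) -
              a * (damped p q th y / y `^ (1 + a))) = 0.
Proof.
move=> a01 p0; have /andP[a0 a1] := a01.
pose F y := damped p q th y * y `^ (- a).
pose f y := y * damped_slope p q th y / y `^ (1 + a) -
              a * (damped p q th y / y `^ (1 + a)).
have H := @Rintegral_derive R _ _ _ F f 0 (measurable_itv _) (exhausts_pos R).
suff : Rintegral mu `]0, +oo[ f = 0 by [].
apply: H.
- move=> y; rewrite /= in_itv/= andbT => y0.
  have d1 := is_derive_damped p q th y.
  have d2 := is_derive_powR_inv a y0.
  apply: is_derive_eq; rewrite /GRing.scale /= powRN1D//.
  by rewrite /f; field; rewrite gt_eqF ?powR_gt0.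
- move=> y; rewrite /= in_itv/= andbT => y0.
  have d1 := is_derive_damped p q th y.
  have ci : {for y, continuous (fun t => (t `^ (1 + a))^-1)}.
    apply: cvgV; first by rewrite gt_eqF// powR_gt0.
    exact: is_derive_continuous (is_derive1_powR (1 + a) y0).
  have cs : {for y, continuous (damped_slope p q th)} by apply: is_derive_continuous.
  apply: cvgB; first by apply: cvgM; [apply: cvgM => //; exact: cs|exact: ci].
  apply: cvgM; first exact: cvg_cst.
  by apply: cvgM; [exact: is_derive_continuous d1|exact: ci].
- apply: integrable_sub => //; first exact: damped_slope_integrable.
  by apply: integrable_scale => //; apply: damped_integrable => //; exact: ltW.
- set C := 2 + p + `|q|.
  have C0 : 0 <= C by rewrite !addr_ge0// ltW.
  rewrite -[X in _ --> X]subr0; apply: cvgB.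
    apply: norm_cvg0; apply: (@squeeze_cvgr _ _ _ _ (fun=> 0)
        (fun n => C * n.+2%:R `^ (- a))).
    - apply: nearW => n; rewrite normr_ge0 normrM (ger0_norm (powR_ge0 _ _)).
      rewrite ler_wpM2r ?powR_ge0// (le_trans (damped_le _ _ _ _))//; first exact: ltW.
      by rewrite -/C ler_piMr// ge_min lexx.
    - exact: cvg_cst.
    - rewrite -[X in _ --> X](mulr0 C); apply: cvgMl_tmp; exact: cvg_powR_natN.
  apply: norm_cvg0; apply: (@squeeze_cvgr _ _ _ _ (fun=> 0)
      (fun n => C * n.+2%:R `^ (- (1 - a)))).
  - apply: nearW => n; rewrite normr_ge0 normrM (ger0_norm (powR_ge0 _ _)).
    have y0 : 0 < n.+2%:R^-1 :> R by rewrite invr_gt0.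
    rewrite -(powR_invN (1 - a))//.
    set y := n.+2%:R^-1 in y0 *.
    have -> : y `^ (1 - a) = y * y `^ (- a).
      rewrite powRD; last by rewrite (@gt_eqF _ _ y) ?implybT.
      by rewrite powRr1// ltW.
    rewrite mulrA ler_wpM2r ?powR_ge0// (le_trans (damped_le _ _ (ltW p0) (ltW y0)))//.
    by rewrite -/C ler_wpM2l// ge_min lexx orbT.
  - exact: cvg_cst.
  - rewrite -[X in _ --> X](mulr0 C); apply: cvgMl_tmp; apply: cvg_powR_natN; lra.
Qed.

(** * From the Gamma integral to the imaginary axis *)

(** The path [s(t) = e^(t (l + i h))] goes from 1 to [e^(l + i h)] and satisfies
    [s' = (l + i h) * s]; these are its real and imaginary parts.  With
    [`|h| = pi / 2] the path ends on the imaginary axis, and it stays in the open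
    right half-plane before. *)
Definition rate_re (R : realType) (l h t : R) : R := expR (t * l) * cos (t * h).
Definition rate_im (R : realType) (l h t : R) : R := expR (t * l) * sin (t * h).

(** The real part of [e^(i phi) * s(t) ^ (- a) * (1 - e^(- s(t) y)) / y ^ (1 + a)];
    the branch of [s ^ (- a)] is the one that is 1 at [t = 0] and continuous along
    the path. *)
Definition path_fun (R : realType) (a l h phi t y : R) : R :=
  expR (- (a * l * t)) *
  (damped (rate_re l h t) (rate_im l h t) (phi - a * h * t) y / y `^ (1 + a)).

(** The derivative in [y] of [damped p q th y * y `^ (- a)]. *)
Definition by_parts_fun (R : realType) (a p q th y : R) : R :=
  y * damped_slope p q th y / y `^ (1 + a) - a * (damped p q th y / y `^ (1 + a)).

(** The derivative along the path is a combination of derivatives in [y]; this is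
    what makes the integral over [y] constant along the path.  The phase shift
    [- (pi / 2)] extracts the imaginary part that is multiplied by [h]. *)
Lemma is_derive_path (R : realType) (a l h phi t y : R) : 0 < y ->
  is_derive t 1 (fun s => path_fun a l h phi s y)
    (expR (- (a * l * t)) *
      (l * by_parts_fun a (rate_re l h t) (rate_im l h t) (phi - a * h * t) y -
       h * by_parts_fun a (rate_re l h t) (rate_im l h t)
             (phi - a * h * t - pi / 2) y)).
Proof.
move=> y0; rewrite /path_fun /damped /rate_re /rate_im.
apply: is_derive_eq; rewrite /by_parts_fun /damped_slope /damped /rate_re /rate_im.
rewrite /GRing.scale /=.
set th := phi - a * h * t.
set p := expR (t * l) * cos (t * h); set q := expR (t * l) * sin (t * h).
rewrite (_ : th - pi / 2 - q * y = (th - q * y) - pi / 2); last by ring.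
rewrite !cosBpihalf !sinBpihalf.
set z := y `^ (1 + a).
rewrite /p /q; ring.
Qed.

Lemma rate_re_gt0 (R : realType) (l h t : R) : `|h| <= pi / 2 -> `|t| < 1 ->
  0 < rate_re l h t.
Proof.
move=> hh t1; rewrite mulr_gt0 ?expR_gt0//; apply: cos_gt0_pihalf.
rewrite -ltr_norml normrM; have := pi_gt0 R; have := normr_ge0 t; have := normr_ge0 h.
nra.
Qed.

Lemma rate_re_ge0 (R : realType) (l h t : R) : `|h| <= pi / 2 -> `|t| <= 1 ->
  0 <= rate_re l h t.
Proof.
move=> hh t1; rewrite mulr_ge0 ?expR_ge0//; apply: cos_ge0_pihalf.
rewrite -ler_norml normrM; have := pi_gt0 R; have := normr_ge0 t; have := normr_ge0 h.
nra.
Qed.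

Lemma rate_le (R : realType) (l h t : R) : `|t| <= 1 ->
  `|rate_re l h t| <= expR `|l| /\ `|rate_im l h t| <= expR `|l|.
Proof.
move=> t1; have E : expR (t * l) <= expR `|l|.
  by rewrite ler_expR (le_trans (ler_norm _))// normrM ler_piMl.
by rewrite /rate_re /rate_im !normrM !(ger0_norm (expR_ge0 _)); split;
  rewrite (le_trans _ E)// ler_piMr ?expR_ge0 ?cos_max ?sin_max.
Qed.

Lemma rate_re_ge (R : realType) (l h t r : R) : `|h| <= pi / 2 -> r <= 1 ->
  `|t| <= r -> expR (- `|l|) * cos (r * (pi / 2)) <= rate_re l h t.
Proof.
move=> hh r1 tr; have pi0 := pi_gt0 R; have t0 := normr_ge0 t.
have h0 := normr_ge0 h.
apply: ler_pM; first exact: expR_ge0.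
- by apply: cos_ge0_pihalf; apply/andP; split; nra.
- rewrite ler_expR -normrN lerNl -mulNr (le_trans (ler_norm _))// normrM normrN.
  by rewrite normrN ler_piMl// (le_trans tr).
- rewrite -[cos (t * h)]cos_norm.
  have hx : `|t * h| \in `[0, pi] by rewrite in_itv/= normr_ge0/= normrM; nra.
  have hy : r * (pi / 2) \in `[0, pi] by rewrite in_itv/=; apply/andP; split; nra.
  by rewrite leNgt ltr_cos// -leNgt normrM ler_pM.
Qed.

Lemma by_parts_fun_integrable (R : realType) (a p q th : R) : 0 < a < 1 -> 0 < p ->
  mu.-integrable `]0, +oo[ (EFin \o by_parts_fun a p q th).
Proof.
move=> a01 p0; apply: integrable_sub => //; first exact: damped_slope_integrable.
by apply: integrable_scale => //; apply: damped_integrable => //; exact: ltW.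
Qed.

Lemma path_integrable (R : realType) (a l h phi t : R) : 0 < a < 1 ->
  `|h| <= pi / 2 -> `|t| <= 1 ->
  mu.-integrable `]0, +oo[ (EFin \o path_fun a l h phi t).
Proof.
move=> a01 hh t1; apply: integrable_scale => //.
by apply: damped_integrable => //; exact: rate_re_ge0.
Qed.

Lemma by_parts_fun_le (R : realType) (a p q th y p0 P : R) : 0 < a < 1 ->
  0 < p0 -> p0 <= p -> `|p| <= P -> `|q| <= P -> 0 < y ->
  `|by_parts_fun a p q th y| <=
    (2 * P * (1 + p0^-1) + (2 + 2 * P)) * power_weight a y.
Proof.
move=> /andP[a0 a1] p00 pp0 pP qP y0.
have p_gt0 : 0 < p by exact: lt_le_trans pp0.
have pP' : p <= P by exact: le_trans (ler_norm _) pP.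
have m0 : 0 <= Num.min 1 y by rewrite le_min ler01 ltW.
have ip : p^-1 <= p0^-1 by rewrite lef_pV2.
have ip0 : 0 < p^-1 by rewrite invr_gt0.
have w0 : 0 <= (y `^ (1 + a))^-1 by rewrite invr_ge0 powR_ge0.
rewrite /by_parts_fun [a * (_ / _)]mulrA -mulrBl normrM (ger0_norm w0).
rewrite /power_weight [leRHS]mulrA (ler_wpM2r w0)//.
rewrite (le_trans (ler_normB _ _))// [leRHS]mulrDl lerD//.
  rewrite (le_trans (damped_slope_le _ _ p_gt0 (ltW y0)))// ler_wpM2r//.
  by apply: ler_pM; have := normr_ge0 q; lra.
rewrite normrM (gtr0_norm a0).
have := damped_le q th (ltW p_gt0) (ltW y0); have := normr_ge0 (damped p q th y).
have h2 : (2 + p + `|q|) * Num.min 1 y <= (2 + 2 * P) * Num.min 1 y.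
  by rewrite ler_wpM2r//; lra.
nra.
Qed.

Definition path_integral (R : realType) (a l h phi t : R) : R :=
  Rintegral mu `]0, +oo[ (path_fun a l h phi t).

(** Near [t] the real part of the path stays above some [p0 > 0], so
    [by_parts_fun_le] bounds the derivative uniformly and one may differentiate
    under the integral sign; [Rintegral_damped_by_parts] then gives 0. *)
Lemma is_derive_path_integral (R : realType) (a l h phi t : R) : 0 < a < 1 ->
  `|h| <= pi / 2 -> `|t| < 1 ->
  is_derive t 1 (path_integral a l h phi) 0.
Proof.
move=> a01 hh t1; have /andP[a0 a1] := a01.
(* a neighbourhood of [t] on which the real part of the path is at least [p0] *)
pose r := (1 + `|t|) / 2.
have tr : `|t| < r by rewrite /r; lra.
have r1 : r < 1 by rewrite /r; lra.
have r0 : 0 < r by have := normr_ge0 t; rewrite /r; lra.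
pose p0 := expR (- `|l|) * cos (r * (pi / 2)).
have p00 : 0 < p0.
  rewrite mulr_gt0 ?expR_gt0//; apply: cos_gt0_pihalf.
  by have pi0 := pi_gt0 R; apply/andP; split; nra.
pose P := expR `|l|.
(* the maximum with 0 only makes the bound nonnegative for negative [y] as well *)
pose G y := P * ((`|l| + `|h|) *
  ((2 * P * (1 + p0^-1) + (2 + 2 * P)) * Num.max 0 (power_weight a y))).
have dpath s y : 0 < y -> derive1 (fun x => path_fun a l h phi x y) s =
    expR (- (a * l * s)) *
      (l * by_parts_fun a (rate_re l h s) (rate_im l h s) (phi - a * h * s) y -
       h * by_parts_fun a (rate_re l h s) (rate_im l h s)
             (phi - a * h * s - pi / 2) y).
  by move=> y0; have [_ <-] := is_derive_path a l h phi s y0; rewrite derive1E.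
have It : `]- r, r[%classic t by rewrite /= in_itv/= -ltr_norml.
have intf s : `]- r, r[%classic s ->
    mu.-integrable `]0, +oo[ (EFin \o path_fun a l h phi s).
  rewrite /= in_itv/= -ltr_norml => sr; apply: path_integrable => //.
  by rewrite ltW// (lt_trans sr).
have derf s y : `]- r, r[%classic s -> `]0, +oo[%classic y ->
    derivable (path_fun a l h phi ^~ y) s 1.
  move=> _; rewrite /= in_itv/= andbT => y0.
  by have [] := is_derive_path a l h phi s y0.
pose K := 2 * P * (1 + p0^-1) + (2 + 2 * P).
have P0 : 0 < P by exact: expR_gt0.
have K0 : 0 <= K.
  by have ip0 : 0 < p0^-1; rewrite ?invr_gt0// /K; nra.
have lh0 : 0 <= `|l| + `|h| by exact: addr_ge0.
have G0 y : 0 <= G y.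
  apply: mulr_ge0; first exact: ltW.
  by apply: mulr_ge0 => //; apply: mulr_ge0; [exact: K0|rewrite le_max lexx].
have wE y : `]0, +oo[%classic y -> Num.max 0 (power_weight a y) = power_weight a y.
  rewrite /= in_itv/= andbT => y0; apply/max_idPr.
  by rewrite divr_ge0 ?powR_ge0// le_min ler01 ltW.
have intG : mu.-integrable `]0, +oo[ (EFin \o G).
  have := integrable_power_weight a01.
  move=> /(integrable_scale K (measurable_itv _)).
  move=> /(integrable_scale (`|l| + `|h|) (measurable_itv _)).
  move=> /(integrable_scale P (measurable_itv _)).
  by apply: eq_integrable => // y /set_mem y0; rewrite /G /= wE.
have G_ub s y : `]- r, r[%classic s -> `]0, +oo[%classic y ->
    `|partial1of2 (path_fun a l h phi) s y| <= G y.
  move=> sr y0; rewrite /G wE//; move: sr y0; rewrite /= !in_itv/= andbT -ltr_norml.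
  move=> sr y0; rewrite /partial1of2 dpath// normrM (ger0_norm (expR_ge0 _)).
  have s1 : `|s| <= 1 by lra.
  have [pP qP] := rate_le l h s1.
  have pp0 := rate_re_ge l hh (ltW r1) (ltW sr).
  have bp th := by_parts_fun_le th a01 p00 pp0 pP qP y0.
  apply: ler_pM => //.
    rewrite /P ler_expR (le_trans (ler_norm _))// normrN -mulrA mulrCA normrM.
    by rewrite ler_piMr// normrM mulr_ile1// ger0_norm ltW.
  rewrite (le_trans (ler_normB _ _))// [leRHS]mulrDl !normrM.
  by apply: lerD; apply: ler_wpM2l.
have mI : measurable (`]0, +oo[%classic : set (measurableTypeR R)).
  exact: measurable_itv.
have D := derivable_under_integral mI It intf derf G0 intG G_ub.
have DE := differentiation_under_integral mI It intf derf G0 intG G_ub.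
split; first exact: D.
rewrite -derive1E [LHS]DE.
have pt := rate_re_gt0 l hh t1.
have ib th := by_parts_fun_integrable (rate_im l h t) th a01 pt.
pose b th := by_parts_fun a (rate_re l h t) (rate_im l h t) th.
transitivity (Rintegral mu `]0, +oo[ (fun y => expR (- (a * l * t)) *
    (l * b (phi - a * h * t) y - h * b (phi - a * h * t - pi / 2) y))).
  apply: eq_Rintegral => y; rewrite inE /= in_itv/= andbT => y0.
  exact: dpath.
have b0 th : Rintegral mu `]0, +oo[ (b th) = 0 by exact: Rintegral_damped_by_parts.
rewrite RintegralZl//; last first.
  by apply: integrable_sub => //; apply: integrable_scale => //; exact: ib.
rewrite RintegralB//; try by apply: integrable_scale => //; exact: ib.
by rewrite !RintegralZl ?b0 ?mulr0 ?subr0 ?mulr0//; exact: ib.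
Qed.

Lemma path_fun_le (R : realType) (a l h phi t y : R) : 0 < a < 1 ->
  `|h| <= pi / 2 -> `|t| <= 1 -> 0 < y ->
  `|path_fun a l h phi t y| <=
    expR `|l| * ((2 + 2 * expR `|l|) * power_weight a y).
Proof.
move=> a01 hh t1 y0; have /andP[a0 a1] := a01.
have [pP qP] := rate_le l h t1.
have p0 := rate_re_ge0 l hh t1.
have w0 : 0 <= (y `^ (1 + a))^-1 by rewrite invr_ge0 powR_ge0.
rewrite /path_fun normrM (ger0_norm (expR_ge0 _)); apply: ler_pM => //.
  rewrite ler_expR (le_trans (ler_norm _))// normrN -mulrA mulrCA normrM.
  by rewrite ler_piMr// normrM mulr_ile1// ger0_norm ltW.
rewrite normrM (ger0_norm w0) /power_weight [leRHS]mulrA (ler_wpM2r w0)//.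
rewrite (le_trans (damped_le _ _ p0 (ltW y0)))// ler_wpM2r//.
  by rewrite le_min ler01 ltW.
by have := ler_norm (rate_re l h t); lra.
Qed.

(** At the end of the path the real part of [s] may vanish and the derivative is no
    longer integrable, so the end point is reached by dominated convergence. *)
Lemma path_integral_const (R : realType) (a l h phi : R) : 0 < a < 1 ->
  `|h| <= pi / 2 -> path_integral a l h phi 1 = path_integral a l h phi 0.
Proof.
move=> a01 hh.
have C t : 0 <= t < 1 -> path_integral a l h phi t = path_integral a l h phi 0.
  move=> /andP[t0 t1]; move: t0; rewrite le_eqVlt => /predU1P[<-//|t0].
  have d s : 0 <= s <= t -> is_derive s 1 (path_integral a l h phi) 0.
    by move=> /andP[s0 st]; apply: is_derive_path_integral => //; rewrite ger0_norm//; lra.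
  have [s||c _ /eqP] := @MVT _ (path_integral a l h phi) (fun=> 0) 0 t t0.
  - by rewrite in_itv/= => /andP[s0 st]; apply: d; rewrite !ltW.
  - apply: derivable_within_continuous => s; rewrite in_itv/= => s0.
    by have [] := d s s0.
  - by rewrite mul0r subr_eq0 => /eqP.
pose t_ n : R := 1 - n.+1%:R^-1.
have t01 n : 0 <= t_ n < 1.
  by rewrite /t_ subr_ge0 invf_le1// ler1n/= gtrDl oppr_lt0 invr_gt0.
have t_1 : t_ n @[n --> \oo] --> (1 : R).
  rewrite -[X in _ --> X]subr0; apply: cvgB; first exact: cvg_cst.
  exact: cvg_harmonic.
have [] := @Rintegral_dominated_cvg R `]0, +oo[ (fun n => path_fun a l h phi (t_ n))
  (path_fun a l h phi 1)
  (fun y => expR `|l| * ((2 + 2 * expR `|l|) * power_weight a y)).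
- exact: measurable_itv.
- move=> n; apply: measurable_funTS; apply: measurable_funM => //.
  by apply: measurable_powR_div; exact: damped_measurable.
- move=> y; rewrite /= in_itv/= andbT => y0.
  have := is_derive_continuous (is_derive_path a l h phi 1 y0).
  by move=> /(cvg_comp _ _ t_1).
- apply: integrable_scale => //; apply: integrable_scale => //.
  exact: integrable_power_weight.
- move=> n y; rewrite /= in_itv/= andbT => y0; apply: path_fun_le => //.
  by have /andP[? ?] := t01 n; rewrite ger0_norm// ltW.
move=> _ lim; apply/esym; apply: (cvg_unique _ _ lim) => //.
rewrite (_ : (fun n => _) = fun=> path_integral a l h phi 0); first exact: cvg_cst.
by apply/funext => n; exact: C.
Qed.

(** The start [s = 1] of the path: integration by parts turns the Gamma integral
    into [Phi 1]. *)
Lemma euler_integral_damped (R : realType) (a : R) : 0 < a < 1 ->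
  Rintegral mu `]0, +oo[ (fun y => damped 1 0 0 y / y `^ (1 + a)) =
  euler_integral (1 - a) / a.
Proof.
move=> a01; have /andP[a0 a1] := a01.
have := Rintegral_damped_by_parts 0 0 a01 ltr01.
rewrite RintegralB//; first last.
- by apply: integrable_scale => //; exact: damped_integrable.
- exact: damped_slope_integrable.
rewrite RintegralZl//; last exact: damped_integrable.
have -> : Rintegral mu `]0, +oo[
    (fun y : R => y * damped_slope 1 0 0 y / y `^ (1 + a)) = euler_integral (1 - a).
  apply: eq_Rintegral => y; rewrite inE /= in_itv/= andbT => y0.
  rewrite /damped_slope mul0r subr0 cos0 mul0r subr0 mul1r !mulr1.
  rewrite (_ : 1 - a - 1 = - a); last by ring.
  by rewrite powRN1D//; ring.
move=> /eqP; rewrite subr_eq0 => /eqP ->.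
by rewrite mulrC mulKf// gt_eqF.
Qed.

(** The value of [Phi] at [i k]: the path with [l = ln `|k|] and
    [h = Num.sg k * (pi / 2)] leads from 1 to [i k], and along it
    [Phi s / s ^ a] keeps its value [Phi 1 = Gamma (1 - a) / a]. *)
Lemma oscillatory_kernel (R : realType) (a phi k : R) : 0 < a < 1 -> k != 0 ->
  Rintegral mu `]0, +oo[ (fun y => (cos phi - cos (phi - k * y)) / y `^ (1 + a)) =
  euler_integral (1 - a) / a *
  (`|k| `^ a * cos (phi + a * (Num.sg k * (pi / 2)))).
Proof.
move=> a01 k0.
pose h := Num.sg k * (pi / 2); pose l := ln `|k|.
have pi0 := pi_gt0 R.
have kn0 : 0 < `|k| by rewrite normr_gt0.
have hh : `|h| <= pi / 2 by rewrite normrM normr_sg k0 mul1r ger0_norm; lra.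
have el : expR l = `|k| by rewrite lnK.
have p1 : rate_re l h 1 = 0.
  by rewrite /rate_re !mul1r /h cos_sg// cos_pihalf mulr0.
have q1 : rate_im l h 1 = k.
  by rewrite /rate_im !mul1r /h sin_sg sin_pihalf mulr1 el mulrC -numEsg.
have := path_integral_const l (phi + a * h) a01 hh.
have -> : path_integral a l h (phi + a * h) 1 = expR (- (a * l)) *
    Rintegral mu `]0, +oo[ (fun y => (cos phi - cos (phi - k * y)) / y `^ (1 + a)).
  rewrite -RintegralZl//; last first.
    have := @damped_integrable _ a 0 k phi a01 (lexx _).
    by apply: eq_integrable => // y _; rewrite /= /damped mul0r oppr0 expR0 mul1r.
  apply: eq_Rintegral => y _; rewrite /path_fun p1 q1 /damped.
  by rewrite mul0r oppr0 expR0 mul1r !mulr1 addrK.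
have -> : path_integral a l h (phi + a * h) 0 =
    cos (phi + a * h) * (euler_integral (1 - a) / a).
  rewrite -euler_integral_damped// -RintegralZl//; last exact: damped_integrable.
  apply: eq_Rintegral => y _.
  rewrite /path_fun /rate_re /rate_im !mul0r expR0 cos0 sin0 !mulr0 oppr0 expR0.
  by rewrite addr0 !mul1r /damped !mul0r !subr0 cos0; ring.
rewrite expRN => /(congr1 (fun z => expR (a * l) * z)).
rewrite mulrA divff ?gt_eqF ?expR_gt0// mul1r => ->.
rewrite /powR gt_eqF// -/l -/h; ring.
Qed.

(** * The Marchaud formula for real functions *)

Lemma powR_le1D (R : realType) (a t : R) : 0 < a < 1 -> 0 < t -> t `^ a <= 1 + t.
Proof.
move=> /andP[a0 a1] t0; case: (lerP 1 t) => t1.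
  by rewrite (le_trans (ler1_powR t1 (ltW a1)))// lerDr.
have : t `^ a <= 1 `^ a by apply: ge0_ler_powR; rewrite ?nnegrE ?ltW.
by rewrite powR1; lra.
Qed.

(** Since [t ^ a <= 1 + t <= e ^ t], the integrand is at least [e ^ (- 2 t)], whose
    integral is [1 / 2]. *)
Lemma euler_integral_gt0 (R : realType) (a : R) : 0 < a < 1 ->
  0 < euler_integral (1 - a).
Proof.
move=> a01; apply: (@lt_le_trans _ _ 2^-1) => //.
have i2 := @abel_integrable R 2 0 0 (ltr0n _ 2).
have ie := damped_slope_integrable 0 0 a01 (@ltr01 R).
have ie' : mu.-integrable `]0, +oo[ (EFin \o
    (fun t : R => t `^ (1 - a - 1) * expR (- t))).
  apply: eq_integrable ie => // y; rewrite inE /= in_itv/= andbT => y0.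
  rewrite /damped_slope mul0r !subr0 cos0 mul0r subr0 mul1r !mulr1.
  rewrite (_ : 1 - a - 1 = - a); last by ring.
  by rewrite powRN1D//; congr EFin; ring.
have <- : Rintegral mu `]0, +oo[ (fun k : R => expR (- (2 * `|k|)) * cos (0 + k * 0)) = 2^-1.
  rewrite Rintegral_itv_obnd_cbnd; last exact: integrable_itv i2.
  transitivity (Rintegral mu `[0, +oo[ (fun k : R => expR (- (2 * k)) * cos (0 + k * 0))).
    by apply: eq_Rintegral => k; rewrite inE /= in_itv/= andbT => k0; rewrite ger0_norm.
  by rewrite abel_half_line// cos0 mul0r subr0; field.
apply: le_Rintegral => //; first exact: integrable_itv i2.
move=> t; rewrite /= in_itv/= andbT => t0.
rewrite gtr0_norm// mulr0 addr0 cos0 mulr1.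
rewrite (_ : 1 - a - 1 = - a); last by ring.
rewrite (_ : - (2 * t) = - t + - t); last by ring.
rewrite expRD ler_wpM2r ?expR_ge0// powRN expRN lef_pV2 ?posrE ?expR_gt0 ?powR_gt0//.
by rewrite (le_trans (powR_le1D a01 t0))// expR_ge1Dx.
Qed.

Lemma increment_integrable (R : realType) (u : R -> R) (a xi : R) :
  0 < a < 1 -> rschwartz u ->
  mu.-integrable `]0, +oo[
    (EFin \o (fun y => (u xi - u (xi - y)) / y `^ (1 + a))).
Proof.
move=> a01 su.
have [M M0 uM] := rschwartz_bounded su.
have [L L0 uL] := rschwartz_bounded (rschwartz_derive1 su).
have lip := lipschitz_derive (rschwartz_is_derive su) uL.
apply: (@le_power_weight _ _ (2 * M + L) (fun y => u xi - u (xi - y))) => //.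
  apply: measurable_funB => //.
  apply: (@measurable_derivable _ _ (fun y => derive1 u (xi - y) * (0 - 1))) => y.
  have H := rschwartz_is_derive su (xi - y).
  exact: (@is_derive1_comp _ u (fun y => xi - y)).
move=> y y0.
have h1 : `|u xi - u (xi - y)| <= L * y.
  by rewrite (le_trans (lip _ _))// opprB addrC subrK ger0_norm.
have h2 : `|u xi - u (xi - y)| <= 2 * M.
  by rewrite (le_trans (ler_normB _ _))// mulr2n mulrDl mul1r lerD.
by case: (lerP 1 y) => y1; nra.
Qed.

(** A phase shift proportional to the frequency is a translation. *)
Lemma wave_translate (R : realType) (u : R -> R) (xi k phi y : R) :
  wave u xi k (phi - k * y) = wave u (xi - y) k phi.
Proof. by apply: eq_Rintegral => x _; congr (_ * cos _); ring. Qed.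

Lemma wave_increment (R : realType) (u : R -> R) (xi k phi y : R) : rschwartz u ->
  wave u xi k phi - wave u xi k (phi - k * y) =
  damped 0 k phi y * wave u xi k 0 +
  damped 0 k (phi - pi / 2) y * wave u xi k (pi / 2).
Proof.
move=> su; rewrite (wave_phase _ _ phi)// (wave_phase _ _ (phi - k * y))//.
rewrite /damped mul0r oppr0 expR0 !mul1r.
rewrite (_ : phi - pi / 2 - k * y = phi - k * y - pi / 2); last by ring.
rewrite !cosBpihalf; ring.
Qed.

(** The increment in [y] acts on the frequency [k] as [1 - e^(- i k y)]; by
    [oscillatory_kernel] its weighted integral is, up to the constant, the symbol
    [(i k) ^ a], a factor [`|k| `^ a] and a phase shift. *)
Lemma wave_increment_Rintegral (R : realType) (u : R -> R) (a xi k phi : R) :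
  0 < a < 1 -> rschwartz u ->
  Rintegral mu `]0, +oo[
    (fun y => (wave u xi k phi - wave u xi k (phi - k * y)) / y `^ (1 + a)) =
  euler_integral (1 - a) / a *
    (`|k| `^ a * wave u xi k (phi + a * (Num.sg k * (pi / 2)))).
Proof.
move=> a01 su; have /andP[a0 a1] := a01.
have [->|k0] := eqVneq k 0.
  rewrite normr0 powR0 ?gt_eqF// mul0r mulr0.
  rewrite (_ : Rintegral _ _ _ = Rintegral mu `]0, +oo[ (fun=> 0)); last first.
    by apply: eq_Rintegral => y _; rewrite mul0r subr0 subrr mul0r.
  by rewrite Rintegral_cst// mul0r.
set w0 := wave u xi k 0; set w1 := wave u xi k (pi / 2).
have id th : mu.-integrable `]0, +oo[
    (EFin \o (fun y => damped 0 k th y / y `^ (1 + a))).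
  exact: damped_integrable.
have E th : Rintegral mu `]0, +oo[ (fun y => damped 0 k th y / y `^ (1 + a)) =
    euler_integral (1 - a) / a *
    (`|k| `^ a * cos (th + a * (Num.sg k * (pi / 2)))).
  rewrite -oscillatory_kernel//; apply: eq_Rintegral => y _.
  by rewrite /damped mul0r oppr0 expR0 mul1r.
transitivity (Rintegral mu `]0, +oo[ (fun y =>
    w0 * (damped 0 k phi y / y `^ (1 + a)) +
    w1 * (damped 0 k (phi - pi / 2) y / y `^ (1 + a)))).
  by apply: eq_Rintegral => y _; rewrite wave_increment// /w0 /w1; ring.
rewrite RintegralD//; try exact: integrable_scale.
rewrite !RintegralZl//; try exact: id.
rewrite !E (wave_phase _ _ (phi + _))// -/w0 -/w1.
rewrite (_ : phi - pi / 2 + _ = phi + a * (Num.sg k * (pi / 2)) - pi / 2); last by ring.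
rewrite cosBpihalf; ring.
Qed.

Lemma wave_increment_inversion (R : realType) (u : R -> R) (xi phi y z : R) :
  rschwartz u ->
  Rintegral mu setT (fun k => (wave u xi k phi - wave u xi k (phi - k * y)) / z) =
  2 * pi * cos phi * ((u xi - u (xi - y)) / z).
Proof.
move=> su.
have i0 := wave_integrable_freq xi phi su.
have i1 := wave_integrable_freq (xi - y) phi su.
transitivity (Rintegral mu setT (fun k =>
    z^-1 * (wave u xi k phi - wave u (xi - y) k phi))).
  by apply: eq_Rintegral => k _; rewrite wave_translate mulrC.
rewrite Rintegral_scale//; last exact: integrable_sub.
by rewrite RintegralB// !wave_inversion//; ring.
Qed.

(** The Marchaud formula.  The function [W] is integrated in both orders: in [y]
    first it gives the symbol by [wave_increment_Rintegral], in [k] first it gives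
    the increments of [u] by [wave_increment_inversion]. *)
Lemma marchaud_real (R : realType) (u : R -> R) (a xi phi : R) :
  0 < a < 1 -> rschwartz u ->
  mu.-integrable setT (EFin \o (fun k : R =>
    `|k| `^ a * wave u xi k (phi + a * (Num.sg k * (pi / 2))))) /\
  Rintegral mu setT (fun k : R =>
    `|k| `^ a * wave u xi k (phi + a * (Num.sg k * (pi / 2)))) =
  2 * pi * cos phi * (a / euler_integral (1 - a) *
    Rintegral mu `]0, +oo[ (fun y => (u xi - u (xi - y)) / y `^ (1 + a))).
Proof.
move=> a01 su; have /andP[a0 a1] := a01.
have E0 := euler_integral_gt0 a01.
have [C C0 HC] := wave_weighted_decay su.
pose W k y := (wave u xi k phi - wave u xi k (phi - k * y)) / y `^ (1 + a).
have mW : measurable_fun [set: R * R] (fun p => W p.1 p.2).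
  have mw th : measurable_fun [set: R * R] (fun p => wave u xi p.1 th).
    exact: (measurableT_comp (wave_measurable xi th su) measurable_fst).
  have md th : measurable_fun [set: R * R] (fun p => damped 0 p.1 th p.2).
    apply: measurable_funB => //; apply: measurable_funM.
      under eq_fun do rewrite mul0r oppr0 expR0.
      exact: measurable_cst.
    apply: (@measurableT_comp _ _ _ _ _ _ cos); first exact: measurable_derivable.
    apply: measurable_funB => //; apply: measurable_funM; first exact: measurable_fst.
    exact: measurable_snd.
  apply: measurable_funM.
    under eq_fun do rewrite wave_increment//.
    by apply: measurable_funD; apply: measurable_funM => //; exact: md.
  under eq_fun do rewrite -powRN.
  exact: (measurableT_comp (measurable_powR (- (1 + a))) measurable_snd).
have [||||i1 _ swap] := @Rintegral_swap R setT `]0, +oo[ W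
  (fun k => 4 * C * (1 / (1 ^+ 2 + (k - 0) ^+ 2))) (power_weight a)
  measurableT (measurable_itv _).
- exact: mW.
- by apply: integrable_scale => //; exact: integrable_cauchy.
- exact: integrable_power_weight.
- move=> k y _; rewrite /= in_itv/= andbT => y0.
  have w0 : 0 <= (y `^ (1 + a))^-1 by rewrite invr_ge0 powR_ge0.
  rewrite /W normrM (ger0_norm w0) /power_weight [leRHS]mulrA (ler_wpM2r w0)//.
  rewrite wave_increment//.
  have m0 : 0 <= Num.min 1 y by rewrite le_min ler01 ltW.
  have dw th w : (1 + `|k|) * `|w| <= C * (1 / (1 ^+ 2 + (k - 0) ^+ 2)) ->
      `|damped 0 k th y * w| <=
      2 * (C * (1 / (1 ^+ 2 + (k - 0) ^+ 2))) * Num.min 1 y.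
    move=> hw; rewrite normrM.
    apply: (@le_trans _ _ (2 * (1 + `|k|) * Num.min 1 y * `|w|)).
      rewrite ler_wpM2r// (le_trans (damped_le _ _ (lexx _) (ltW y0)))//.
      by rewrite ler_wpM2r//; have := normr_ge0 k; lra.
    rewrite (_ : _ * `|w| = 2 * ((1 + `|k|) * `|w|) * Num.min 1 y); last by ring.
    by rewrite ler_wpM2r// ler_wpM2l.
  rewrite (le_trans (ler_normD _ _))//.
  rewrite (_ : 4 * C * _ * _ = 2 * (C * (1 / (1 ^+ 2 + (k - 0) ^+ 2))) * Num.min 1 y +
    2 * (C * (1 / (1 ^+ 2 + (k - 0) ^+ 2))) * Num.min 1 y); last by ring.
  by apply: lerD; apply: dw; exact: HC.
pose V k := `|k| `^ a * wave u xi k (phi + a * (Num.sg k * (pi / 2))).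
pose c := euler_integral (1 - a) / a.
have c0 : c != 0 by rewrite mulf_neq0 ?invr_eq0 ?gt_eqF.
have EW k : Rintegral mu `]0, +oo[ (W k) = c * V k.
  exact: wave_increment_Rintegral.
pose J := Rintegral mu `]0, +oo[ (fun y => (u xi - u (xi - y)) / y `^ (1 + a)).
have EJ : Rintegral mu `]0, +oo[ (fun y => Rintegral mu setT (W ^~ y)) =
    2 * pi * cos phi * J.
  have ii := increment_integrable xi a01 su.
  have Z := Rintegral_scale (2 * pi * cos phi) (measurable_itv _) ii.
  rewrite -[RHS]Z {Z}; apply: eq_Rintegral => y _.
  exact: wave_increment_inversion.
have key : Rintegral mu setT (fun k => c * V k) = 2 * pi * cos phi * J.
  transitivity (Rintegral mu setT (fun k => Rintegral mu `]0, +oo[ (W k))).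
    by apply: eq_Rintegral => k _; exact: esym (EW k).
  exact: etrans swap EJ.
clear swap EJ.
have iV : mu.-integrable setT (EFin \o V).
  apply: eq_integrable (integrable_scale c^-1 measurableT i1); first by [].
  by move=> k _; rewrite /= EW mulKf.
split; first exact: iV.
move: key; rewrite Rintegral_scale; [|exact: measurableT|exact: iV].
move=> /(congr1 (fun z => c^-1 * z)); rewrite mulKf// -/J => ->.
rewrite /c invf_div; ring.
Qed.

(** * Complex functions and the Hirota operator *)

Lemma cmod_ge (R : realType) (z : R[i]) :
  `|complex.Re z| <= cmod z /\ `|complex.Im z| <= cmod z.
Proof.
case: z => x y; rewrite /cmod /=.
by split; rewrite -sqrtr_sqr ler_wsqrtr// ?lerDl ?lerDr sqr_ge0.
Qed.

Lemma schwartz_rschwartz (R : realType) (f : R -> R[i]) : schwartz f ->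
  rschwartz (@complex.Re R \o f) /\ rschwartz (@complex.Im R \o f).
Proof.
move=> [sf fM]; split; split=> [n x|m n]; try by have [] := sf n x.
- have [M HM] := fM m n; exists M => x; rewrite (le_trans _ (HM x))// ler_wpM2l//.
  by have [] := cmod_ge (cderiven n f x).
- have [M HM] := fM m n; exists M => x; rewrite (le_trans _ (HM x))// ler_wpM2l//.
  by have [] := cmod_ge (cderiven n f x).
Qed.

Lemma complexME (R : realType) (a b c d : R) :
  (a +i* b) * (c +i* d) = (a * c - b * d) +i* (a * d + b * c).
Proof. by []. Qed.

Lemma complexBE (R : realType) (a b c d : R) :
  (a +i* b) - (c +i* d) = (a - c) +i* (b - d).
Proof. by []. Qed.

Lemma cexp_im (R : realType) (t : R) : cexp (0 +i* t) = cos t +i* sin t.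
Proof. by rewrite /cexp /= expR0 mul1r. Qed.

(** Both sides vanish at [k = 0]; otherwise the principal argument of [i k] is
    [pi / 2] with the sign of [k]. *)
Lemma cpow_imaginary (R : realType) (a k : R) : a != 0 ->
  cpow (0 +i* k) a =
  (`|k| `^ a)%:C * (cos (a * (Num.sg k * (pi / 2))) +i* sin (a * (Num.sg k * (pi / 2)))).
Proof.
move=> a0; rewrite /cpow; have [->|k0] := eqVneq k 0.
  by rewrite eqxx normr0 powR0// mul0r.
rewrite ifF; last first.
  by apply/negbTE/negP => /eqP [] /eqP; rewrite (negbTE k0).
have cm : cmod (0 +i* k) = `|k| by rewrite /cmod /= expr0n add0r sqrtr_sqr.
have ca : carg (0 +i* k) = Num.sg k * (pi / 2).
  rewrite /carg /= mul0r acos0; case: (ltgtP 0 k) k0 => [kp _|kn _|//].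
    by rewrite gtr0_sg// mul1r.
  by rewrite ltr0_sg// mulN1r.
rewrite /clog cm ca /cexp /=.
rewrite !mul0r subr0 addr0 /powR normr_eq0 (negbTE k0).
by [].
Qed.

Lemma wave_recenter (R : realType) (u : R -> R) (xi k phi : R) :
  wave u xi k phi = wave u 0 k (phi + k * xi).
Proof. by apply: eq_Rintegral => x _; congr (_ * cos _); ring. Qed.

Lemma fourier_wave (R : realType) (f : R -> R[i]) (k : R) : schwartz f ->
  let u := @complex.Re R \o f in let v := @complex.Im R \o f in
  fourier f k = (wave u 0 k 0 + wave v 0 k (pi / 2)) +i*
                (wave v 0 k 0 - wave u 0 k (pi / 2)).
Proof.
move=> /schwartz_rschwartz [su sv] u v.
have iu phi := wave_integrable 0 k phi su.
have iv phi := wave_integrable 0 k phi sv.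
rewrite /fourier /cintegral; congr (_ +i* _).
- rewrite -RintegralD//; apply: eq_Rintegral => x _.
  rewrite cexp_im /= /u /v /=; case: (f x) => p q /=.
  rewrite [pi / 2 + _]addrC cosDpihalf add0r sub0r mulrN; ring.
- rewrite -RintegralB//; apply: eq_Rintegral => x _.
  rewrite cexp_im /= /u /v /=; case: (f x) => p q /=.
  rewrite [pi / 2 + _]addrC cosDpihalf add0r sub0r mulrN; ring.
Qed.

(** The phase [pi / 2] is the factor [i] of the imaginary part of [f]; the phase
    [- (pi / 2)] turns a real part into an imaginary part. *)
Lemma symbol_wave (R : realType) (f : R -> R[i]) (a xi k : R) : a != 0 ->
  schwartz f ->
  let u := @complex.Re R \o f in let v := @complex.Im R \o f in
  let th := a * (Num.sg k * (pi / 2)) in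
  cpow (0 +i* k) a * fourier f k * cexp (0 +i* (k * xi)) =
  (`|k| `^ a * wave u xi k (0 + th) + `|k| `^ a * wave v xi k (pi / 2 + th)) +i*
  (`|k| `^ a * wave u xi k (- (pi / 2) + th) + `|k| `^ a * wave v xi k (0 + th)).
Proof.
move=> a0 sf u v th; have [su sv] := schwartz_rschwartz sf.
rewrite cpow_imaginary// fourier_wave// cexp_im -/th -/u -/v.
rewrite !(wave_recenter _ xi).
rewrite (wave_phase _ _ (0 + th + k * xi) su) (wave_phase _ _ (0 + th + k * xi) sv).
rewrite (wave_phase _ _ (- (pi / 2) + th + k * xi) su).
rewrite (wave_phase _ _ (pi / 2 + th + k * xi) sv).
rewrite (_ : - (pi / 2) + th + k * xi = th + k * xi - pi / 2); last by ring.
rewrite (_ : pi / 2 + th + k * xi = th + k * xi + pi / 2); last by ring.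
rewrite cosBpihalf sinBpihalf cosDpihalf sinDpihalf add0r cosD sinD.
rewrite !complexME; congr (_ +i* _); ring.
Qed.

(** In [marchaud_real] the factor [cos phi] is 1 for the phase 0 and removes the
    terms of phase [pi / 2] and [- (pi / 2)]. *)
Lemma fracD_marchaud (R : realType) (f : R -> R[i]) (a xi : R) : 0 < a < 1 ->
  schwartz f ->
  let u := @complex.Re R \o f in let v := @complex.Im R \o f in
  let incr w := Rintegral mu `]0, +oo[
                  (fun y => (w xi - w (xi - y)) / y `^ (1 + a)) in
  fracD a f xi = (a / euler_integral (1 - a))%:C * (incr u +i* incr v).
Proof.
move=> a01 sf u v incr; have /andP[a0 a1] := a01.
have [su sv] := schwartz_rschwartz sf.
have an0 : a != 0 by rewrite gt_eqF.
rewrite /fracD /inverse_fourier /cintegral.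
have [iu0 Eu0] := marchaud_real xi 0 a01 su.
have [iu1 Eu1] := marchaud_real xi (- (pi / 2)) a01 su.
have [iv0 Ev0] := marchaud_real xi 0 a01 sv.
have [iv1 Ev1] := marchaud_real xi (pi / 2) a01 sv.
have ERe : Rintegral mu setT (@complex.Re R \o (fun k =>
    cpow (0 +i* k) a * fourier f k * cexp (0 +i* (k * xi)))) =
    2 * pi * (a / euler_integral (1 - a) * incr u).
  under eq_Rintegral do rewrite /= symbol_wave//=.
  by rewrite RintegralD// Eu0 Ev1 cos0 cos_pihalf mulr0 mul0r addr0 mulr1.
have EIm : Rintegral mu setT (@complex.Im R \o (fun k =>
    cpow (0 +i* k) a * fourier f k * cexp (0 +i* (k * xi)))) =
    2 * pi * (a / euler_integral (1 - a) * incr v).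
  under eq_Rintegral do rewrite /= symbol_wave//=.
  by rewrite RintegralD// Eu1 Ev0 cos0 cosN cos_pihalf mulr0 mul0r add0r mulr1.
rewrite ERe EIm !complexME.
have pi2 : 2 * pi != 0 :> R by rewrite mulf_neq0// gt_eqF// pi_gt0.
by rewrite !mul0r !subr0 !addr0 !(mulKf pi2).
Qed.

Lemma Gamma_1B (R : realType) (a : R) : a < 1 -> Gamma (1 - a) = euler_integral (1 - a).
Proof. by move=> a1; rewrite /Gamma subr_gt0 a1 addr0 big_ord0 divr1. Qed.

Lemma Gamma_N (R : realType) (a : R) : 0 < a < 1 ->
  Gamma (- a) = - (euler_integral (1 - a) / a).
Proof.
move=> /andP[a0 a1]; rewrite /Gamma oppr_gt0 ltNge (ltW a0)/= opprK.
have -> : Num.truncn a = 0%N.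
  by apply: truncn_def; rewrite (ltW a0) a1.
rewrite big_ord1 addr0 (addrC (- a)); field; lra.
Qed.

Unset Implicit Arguments.

Theorem theorem3p3 (R : realType) (alpha : R) (f g : R -> R[i])
    (halpha : 0 < alpha < 1) (hf : schwartz f) (hg : schwartz g) :
  (forall xi : R,
     let integrand := fun y : R =>
       (f xi * g (xi - y) - f (xi - y) * g xi) / (y `^ (1 + alpha))%:C in
     cintegrable `]0, +oo[ integrand /\
     hirota alpha f g xi =
       (alpha / Gamma (1 - alpha))%:C * cintegral `]0, +oo[ integrand) /\
  alpha / Gamma (1 - alpha) = - (1 / Gamma (- alpha)).
Proof.
have /andP[a0 a1] := halpha.
have E0 := euler_integral_gt0 halpha.
split; last first.
  by rewrite Gamma_1B// Gamma_N//; field; rewrite !gt_eqF.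
move=> xi integrand.
have [su sv] := schwartz_rschwartz hf; have [sp sq] := schwartz_rschwartz hg.
have iu := increment_integrable xi halpha su.
have iv := increment_integrable xi halpha sv.
have ip := increment_integrable xi halpha sp.
have iq := increment_integrable xi halpha sq.
pose d (w : R -> R) y := (w xi - w (xi - y)) / y `^ (1 + alpha).
pose u := @complex.Re R \o f; pose v := @complex.Im R \o f.
pose p := @complex.Re R \o g; pose q := @complex.Im R \o g.
(* the products [f xi * g xi] cancel: both components of the integrand are
   combinations of the increments of the four real functions *)
pose lin (c1 c2 c3 c4 : R) y := c1 * d u y + c2 * d v y - (c3 * d p y + c4 * d q y).
have ilin c1 c2 c3 c4 : mu.-integrable `]0, +oo[ (EFin \o lin c1 c2 c3 c4).
  by apply: integrable_sub => //; apply: integrable_add => //; exact: integrable_scale.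
have Elin c1 c2 c3 c4 : Rintegral mu `]0, +oo[ (lin c1 c2 c3 c4) =
    c1 * Rintegral mu `]0, +oo[ (d u) + c2 * Rintegral mu `]0, +oo[ (d v) -
    (c3 * Rintegral mu `]0, +oo[ (d p) + c4 * Rintegral mu `]0, +oo[ (d q)).
  rewrite RintegralB//; try by apply: integrable_add => //; exact: integrable_scale.
  rewrite !RintegralD//; try exact: integrable_scale.
  by rewrite !Rintegral_scale.
have ERe : @complex.Re R \o integrand = lin (p xi) (- q xi) (u xi) (- v xi).
  apply/funext => y; rewrite /integrand /lin /d /u /v /p /q /= -fmorphV/=.
  case: (f xi) (g xi) (f (xi - y)) (g (xi - y)) => [? ?] [? ?] [? ?] [? ?] /=.
  by rewrite /=; ring.
have EIm : @complex.Im R \o integrand = lin (q xi) (p xi) (v xi) (u xi).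
  apply/funext => y; rewrite /integrand /lin /d /u /v /p /q /= -fmorphV/=.
  case: (f xi) (g xi) (f (xi - y)) (g (xi - y)) => [? ?] [? ?] [? ?] [? ?] /=.
  by rewrite /=; ring.
split; first by split; rewrite ?ERe ?EIm; exact: ilin.
have -> : hirota alpha f g xi = fracD alpha f xi * (p xi +i* q xi) -
    (u xi +i* v xi) * fracD alpha g xi.
  by rewrite /hirota /u /v /p /q /=; case: (f xi); case: (g xi).
rewrite /cintegral ERe EIm !Elin Gamma_1B//.
have -> : fracD alpha f xi = (alpha / euler_integral (1 - alpha))%:C *
    (Rintegral mu `]0, +oo[ (d u) +i* Rintegral mu `]0, +oo[ (d v)).
  exact: fracD_marchaud.
have -> : fracD alpha g xi = (alpha / euler_integral (1 - alpha))%:C *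
    (Rintegral mu `]0, +oo[ (d p) +i* Rintegral mu `]0, +oo[ (d q)).
  exact: fracD_marchaud.
rewrite !complexME complexBE.
by congr (_ +i* _); ring.
Qed.
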